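(* Let $u,v,w$ be weights on $(0,\infty)$ with $\lim_{t\to\infty}V(t)=\infty$, and let $0<p<\infty$. Assume that $u$ is such that $U$ is admissible. Let $$\varphi(t):=\operatorname*{ess\,sup}_{s\in(0,t)}U(s)\operatorname*{ess\,sup}_{\tau\in(s,\infty)}\frac{w(\tau)}{U(\tau)},\qquad t\in(0,\infty),$$ be non-degenerate with respect to $U$. Consider the inequality $$\operatorname*{ess\,sup}_{x\in(0,\infty)}w(x)\,\frac1{U(x)}\int_0^xf(t)u(t)\,dt\le c\left(\int_0^\infty f(x)^pv(x)\,dx\right)^{\frac1p}\qquad( * )$$ for non-negative non-increasing measurable functions $f$ on $(0,\infty)$, where $c$ is a finite constant independent of $f$. (i) Let $0<p\le1$. Then $( * )$ holds for every such $f$ if and only if $$C_5:=\sup_{x\in(0,\infty)}\left(\operatorname*{ess\,sup}_{s\in(0,\infty)}w(s)\,\mathcal U(x,s)\right)U(x)^{-1}\left(\sup_{t\in(0,x)}U(t)V(t)^{-\frac1p}\right)<\infty .$$ Moreover, the best constant $c$ in $( * )$ satisfies $c\approx C_5$. (ii) Let $1<p<\infty$. Then $( * )$ holds for every such $f$ if and only if $$C_6:=\sup_{x\in(0,\infty)}\left(\operatorname*{ess\,sup}_{s\in(0,\infty)}w(s)\,\mathcal U(x,s)\right)\left(\int_0^\infty\mathcal U(t,x)^{p'}\frac{v(t)}{V(t)^{p'}}\,dt\right)^{\frac1{p'}}<\infty .$$ Moreover, the best constant $c$ in $( * )$ satisfies $c\approx C_6$.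
   Context: A weight is a locally integrable non-negative function on $(0,\infty)$. $U(t)=\int_0^tu(s)\,ds$, $V(t)=\int_0^tv(s)\,ds$, with $U(t)>0$ for all $t>0$; $\mathcal U(x,t)=\dfrac{U(x)}{U(t)+U(x)}$; $p'$ is defined by $1/p+1/p'=1$. $U$ is admissible if it is continuous and strictly increasing on $[0,\infty)$, $U(0)=0$ and $\lim_{t\to\infty}U(t)=\infty$. A function $\varphi$ is non-degenerate with respect to $U$ if $$\lim_{t\to0+}\varphi(t)=\lim_{t\to\infty}\frac1{\varphi(t)}=\lim_{t\to\infty}\frac{\varphi(t)}{U(t)}=\lim_{t\to0+}\frac{U(t)}{\varphi(t)}=0 .$$ Conventions: $1/0=\infty$, $1/\infty=0$, $0\cdot\infty=0$, $0/0=0$, $\infty/\infty=0$. $a\approx b$ means $\lambda^{-1}a\le b\le\lambda a$ with $\lambda>0$ depending only on inessential parameters (here $p$). *)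

(* Defs.v *)
From HB Require Import structures.
From mathcomp Require Import all_boot all_order all_algebra.
From mathcomp Require Import all_classical all_reals all_analysis ess_sup_inf.

Set Implicit Arguments.
Unset Strict Implicit.
Unset Printing Implicit Defensive.

Import Order.TTheory GRing.Theory Num.Theory.
Import numFieldNormedType.Exports.

Local Open Scope classical_set_scope.
Local Open Scope ring_scope.
Local Open Scope ereal_scope.

(* Extended-real conventions: in the library [0^-1 = +oo], [+oo^-1 = 0] and
   [0 * +oo = 0], hence also [0 / 0 = 0] and [+oo / +oo = 0].  The library power
   [x `^ r] is only meaningful here for [r > 0] (for instance [+oo `^ r = +oo]
   when [r < 0]), so negative powers are written as inverses of positive
   powers. *)

Section weighted_inequality.
Context {R : realType}.
Notation mu := (@lebesgue_measure R).
Implicit Types (u v w f : R -> R) (U V : R -> \bar R) (p x t : R).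

Definition ess_sup_on (i : interval R) (g : R -> \bar R) : \bar R :=
  ess_sup (mrestr mu (measurable_itv i)) g.

Definition weight w : Prop :=
  locally_integrable `]0%R, +oo[ w /\ (forall x, (0 < x)%R -> (0 <= w x)%R).

(* [U] and [V] are [primitive u] and [primitive v]; the value is [+oo] when the
   weight is not integrable near the origin. *)
Definition primitive u t : \bar R := \int[mu]_(s in `]0%R, t[) (u s)%:E.

(* Strict monotonicity forces [U] to be finite on [0, +oo). *)
Definition admissible U : Prop :=
  [/\ {within `[0%R, +oo[, continuous U},
      (forall s t : R, (0 <= s)%R -> (s < t)%R -> U s < U t),
      U 0%R = 0 &
      U t @[t --> +oo%R] --> +oo].

Definition nondegenerate_wrt U (phi : R -> \bar R) : Prop :=
  [/\ phi t @[t --> 0%R^'+] --> 0,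
      (phi t)^-1 @[t --> +oo%R] --> 0,
      phi t / U t @[t --> +oo%R] --> 0 &
      U t / phi t @[t --> 0%R^'+] --> 0].

Definition calU U x t : \bar R := U x / (U t + U x).

Definition fundamental U w t : \bar R :=
  ess_sup_on `]0%R, t[ (fun s =>
    U s * ess_sup_on `]s, +oo[ (fun tau => (w tau)%:E / U tau)).

Definition nonneg_nonincreasing f : Prop :=
  [/\ measurable_fun (`]0%R, +oo[ : set R) f,
      (forall x, (0 < x)%R -> (0 <= f x)%R) &
      (forall x y, (0 < x)%R -> (x <= y)%R -> (f y <= f x)%R)].

Definition hardy_lhs u w f : \bar R :=
  ess_sup_on `]0%R, +oo[ (fun x =>
    (w x)%:E * (primitive u x)^-1 * \int[mu]_(t in `]0%R, x[) (f t * u t)%:E).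

Definition weighted_norm p v f : \bar R :=
  (\int[mu]_(x in `]0%R, +oo[) (f x `^ p * v x)%:E) `^ p^-1.

Definition hardy_constants p u v w : set R :=
  [set c | (0 <= c)%R /\
    forall f, nonneg_nonincreasing f ->
      hardy_lhs u w f <= c%:E * weighted_norm p v f].

(* [+oo] when no finite constant works. *)
Definition best_const p u v w : \bar R :=
  ereal_inf [set c%:E | c in hardy_constants p u v w].

Definition C5 p u v w : \bar R :=
  let U := primitive u in let V := primitive v in
  ereal_sup [set
      ess_sup_on `]0%R, +oo[ (fun s => (w s)%:E * calU U x s)
    * (U x)^-1
    * ereal_sup [set U t / (V t `^ p^-1) | t in `]0%R, x[]
  | x in `]0%R, +oo[].

Definition C6 (p' : R) u v w : \bar R :=
  let U := primitive u in let V := primitive v in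
  ereal_sup [set
      ess_sup_on `]0%R, +oo[ (fun s => (w s)%:E * calU U x s)
    * (\int[mu]_(t in `]0%R, +oo[)
         (calU U t x `^ p' * ((v t)%:E / (V t `^ p')))) `^ p'^-1
  | x in `]0%R, +oo[].

Definition approx_with (lam : R) (a b : \bar R) : Prop :=
  (lam^-1)%:E * a <= b /\ b <= lam%:E * a.

End weighted_inequality.

(* Main.v *)
(* Write [A x] for the essential supremum of [w s * calU x s] in [s], [I x] for
   the integral of [f * u] over [(0, x)] and [N f] for the weighted norm.

   (1) [c] bounds [hardy_lhs u w f] by [c * N f] if and only if, up to a factor 3,
   [A x / U x * I x <= c * N f] for every [x > 0]: one direction uses that [I]
   increases and [I / U] decreases, the other that a.e. [s] satisfies the
   inequality for all rational [x], one of which has [s < x] and [U x <= 2 * U s].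

   (2) Along points [t_n] where [V] decreases geometrically, [I x] is at most
   the sum of the [f (t_(n+1)) * U (t_n)], while the sum of the
   [f (t_(n+1)) `^ p * V (t_n)] is at most [4 * N f `^ p].  Subadditivity of
   [z `^ p] (if [p <= 1]) or Hoelder's inequality (if [1 < p]) then bounds [I x]
   by the quantity appearing in [C5] or [C6].

   (3) Conversely, [C5] is tested on indicators of [(0, t)], and [C6] on step
   functions with jumps at the points [t_n], whose norm is controlled by a
   discrete Hardy inequality with geometric weights.

   Two degenerate cases are separate: if [V = +oo] then [f = 0] whenever [N f] is
   finite, and if [V] vanishes near the origin then either side of the
   equivalence forces [A = 0]. *)

Require Import Defs.
From HB Require Import structures.
From mathcomp Require Import all_boot all_order all_algebra.
From mathcomp Require Import all_classical all_reals all_analysis ess_sup_inf measurable_realfun.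
From mathcomp Require Import ring lra.

Set Implicit Arguments.
Unset Strict Implicit.
Unset Printing Implicit Defensive.

Import Order.TTheory GRing.Theory Num.Theory.
Import numFieldNormedType.Exports.

Local Open Scope classical_set_scope.
Local Open Scope ring_scope.
Local Open Scope ereal_scope.

(** * Integrals of non-negative functions over subintervals of the half-line *)

Section half_line.
Context {R : realType}.
Notation mu := (@lebesgue_measure R).
Implicit Types (f g h : R -> R) (a b c k s x y : R).

Definition nonneg_measurable g : Prop :=
  measurable_fun (`]0%R, +oo[ : set R) g /\ (forall x, (0 < x)%R -> (0 <= g x)%R).

Lemma nonneg_measurableM f g : nonneg_measurable f -> nonneg_measurable g ->
  nonneg_measurable (fun x => (f x * g x)%R).
Proof.
move=> [mf f0] [mg g0]; split; first exact: measurable_funM.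
by move=> x x0; rewrite mulr_ge0 ?f0 ?g0.
Qed.

Lemma nonneg_measurable_powR f r : nonneg_measurable f ->
  nonneg_measurable (fun x => (f x `^ r)%R).
Proof.
move=> [mf f0]; split; last by move=> x _; exact: powR_ge0.
exact: (measurableT_comp (measurable_powR r) mf).
Qed.

Lemma weight_nonneg_measurable w : weight w -> nonneg_measurable w.
Proof. by move=> [[mw _ _] w0]. Qed.

Lemma nonneg_nonincreasing_measurable f :
  nonneg_nonincreasing f -> nonneg_measurable f.
Proof. by case. Qed.

Lemma sub_half_line (i : interval R) x : [set` i] `<=` `]0%R, +oo[%classic ->
  x \in i -> (0 < x)%R.
Proof. by move=> iD xi; have := iD x xi; rewrite /= in_itv/= andbT. Qed.

Lemma nonneg_measurable_on (i : interval R) g :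
  [set` i] `<=` `]0%R, +oo[%classic -> nonneg_measurable g ->
  measurable_fun [set` i] (fun x => (g x)%:E) /\
  (forall x, [set` i] x -> 0 <= (g x)%:E).
Proof.
move=> iD [mg g0]; split.
  by apply/measurable_EFinP; apply: measurable_funS mg.
by move=> x xi; rewrite lee_fin g0// (sub_half_line iD).
Qed.

Lemma sub_half_line_ob (b : itv_bound R) :
  [set` Interval (BRight 0%R) b] `<=` `]0%R, +oo[%classic.
Proof. by move=> x/=; rewrite !in_itv/= => /andP[-> _]. Qed.

Lemma sub_half_line_cb a (b : itv_bound R) : (0 < a)%R ->
  [set` Interval (BLeft a) b] `<=` `]0%R, +oo[%classic.
Proof.
by move=> a0 x/=; rewrite !in_itv/= => /andP[ax _]; rewrite (lt_le_trans a0).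
Qed.

(** The left bound [l] stays generic so that one split serves both []0, b[] and half-open blocks. *)
Lemma nonneg_integral_split (l : itv_bound R) a b g : nonneg_measurable g ->
  (BRight 0%R <= l)%O -> (l <= BLeft a)%O -> (a <= b)%R ->
  \int[mu]_(x in [set` Interval l (BLeft b)]) (g x)%:E =
  \int[mu]_(x in [set` Interval l (BLeft a)]) (g x)%:E +
  \int[mu]_(x in `[a, b[) (g x)%:E.
Proof.
move=> gm l0 la ab.
have lD : [set` Interval l (BLeft b)] `<=` `]0%R, +oo[%classic.
  move=> x/= /[!itv_boundlr]/= /andP[lx _]; rewrite andbT.
  exact: le_trans lx.
have [mg g0] := nonneg_measurable_on lD gm.
rewrite (@itv_bndbnd_setU _ _ l (BLeft a) (BLeft b))// in mg g0 *.
rewrite ge0_integral_setU//.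
apply/disj_setPRL => x/=; rewrite !itv_boundlr/= => /andP[ax _].
by move=> /andP[_ xa]; have := le_trans xa ax; rewrite leBRight_ltBLeft ltxx.
Qed.

(** The points decrease, so each new index adds a block at the left end. *)
Lemma ladder_integral (t : nat -> R) g N : nonneg_measurable g ->
  (forall n, (0 < t n)%R) -> (forall n, (t n.+1 <= t n)%R) ->
  \int[mu]_(x in `[t N, t 0%N[) (g x)%:E =
  \sum_(n < N) \int[mu]_(x in `[t n.+1, t n[) (g x)%:E.
Proof.
move=> gm t0 tS.
have tN0 n : (t n <= t 0%N)%R.
  by elim: n => // n IH; exact: le_trans (tS n) IH.
elim: N => [|N IH].
  by rewrite big_ord0 set_itvco0 integral_set0.
rewrite big_ord_recr/= -IH addeC.
by rewrite (nonneg_integral_split (l := BLeft (t N.+1)) gm _ _ (tN0 N)) ?bnd_simp ?tS ?t0.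
Qed.

(** Monotone convergence: the integrals over the increasing sets [F n] tend to the integral over
    their union, which contains [D]. *)
Lemma nonneg_integral_exhaust (D : set R) (F : nat -> set R) g (L : \bar R) :
  (forall n, measurable (F n)) -> {homo F : n m / (n <= m)%N >-> n `<=` m} ->
  D `<=` \bigcup_n F n -> (forall n, F n `<=` `]0%R, +oo[%classic) ->
  measurable D -> nonneg_measurable g ->
  (forall n, \int[mu]_(x in F n) (g x)%:E <= L) ->
  \int[mu]_(x in D) (g x)%:E <= L.
Proof.
move=> mF ndF DF F0 mD [mg g0] FL.
have mgF n : measurable_fun (F n) (fun x => (g x)%:E).
  by apply/measurable_EFinP; apply: measurable_funS mg => //; exact: F0.
have UF0 : \bigcup_n F n `<=` `]0%R, +oo[%classic.
  by move=> x [n _ /F0].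
have gF0 x : `]0%R, +oo[%classic x -> 0 <= (g x)%:E.
  by rewrite /= in_itv/= andbT lee_fin; exact: g0.
apply: (@le_trans _ _ (\int[mu]_(x in \bigcup_n F n) (g x)%:E)).
  apply: ge0_subset_integral => //; first exact: bigcupT_measurable.
    by apply/measurable_EFinP; apply: measurable_funS mg => //; exact: measurable_itv.
  by move=> x /UF0; exact: gF0.
have gFn n x : F n x -> 0 <= (g x)%:E by move=> /F0; exact: gF0.
have nd : {homo F : n m / (n <= m)%N >-> (n <= m)%O}.
  by move=> n m nm; apply/subsetPset; exact: ndF.
have cv := ge0_nondecreasing_set_cvg_integral (mu := mu) nd mF mgF gFn.
rewrite -(cvg_lim _ cv)//; apply: lime_le; first by apply/cvg_ex; eexists; exact: cv.
by apply: nearW => n; exact: FL.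
Qed.

Lemma nonneg_integral_exhaust_left b g (L : \bar R) : nonneg_measurable g ->
  (0 < b)%R ->
  (forall a, (0 < a)%R -> (a < b)%R ->
    \int[mu]_(x in `[a, b[) (g x)%:E <= L) ->
  \int[mu]_(x in `]0%R, b[) (g x)%:E <= L.
Proof.
move=> gm b0 gL.
(* The divisor [n.+2] rather than [n.+1] keeps every left endpoint strictly below [b], as [gL]
   requires. *)
apply: (@nonneg_integral_exhaust _ (fun n => `[(b / n.+2%:R)%R, b[%classic)) => //.
- move=> n m nm x/=; rewrite !in_itv/= => /andP[bx ->]; rewrite andbT.
  by apply: le_trans bx; rewrite ler_pM2l// lef_pV2 ?posrE// ler_nat.
- move=> x/=; rewrite in_itv/= => /andP[x0 xb].
  have [n _ nP] : \forall n \near \oo, (n.+1%:R^-1 < x / b :> R)%R.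
    by apply: (near_infty_natSinv_lt (PosNum (divr_gt0 x0 b0))).
  exists n => //=; rewrite in_itv/= xb andbT.
  have /ltW := nP n.+1 (leqnSn n).
  by rewrite ler_pdivlMr// mulrC.
- by move=> n; apply: sub_half_line_cb; rewrite divr_gt0.
- move=> n; apply: gL; first by rewrite divr_gt0.
  by rewrite ltr_pdivrMr// ltr_pMr// ltr1n.
Qed.

Lemma nonneg_integral_exhaust_right g (L : \bar R) : nonneg_measurable g ->
  (forall b, (0 < b)%R -> \int[mu]_(x in `]0%R, b[) (g x)%:E <= L) ->
  \int[mu]_(x in `]0%R, +oo[) (g x)%:E <= L.
Proof.
move=> gm gL.
apply: (@nonneg_integral_exhaust _ (fun n => `]0%R, n.+1%:R[%classic)) => //.
- move=> n m nm x/=; rewrite !in_itv/= => /andP[-> xn]/=.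
  by rewrite (lt_le_trans xn)// ler_nat.
- move=> x/=; rewrite in_itv/= andbT => x0.
  exists (Num.truncn x) => //=; rewrite in_itv/= x0/=.
  by rewrite truncnS_gt.
- by move=> n; exact: sub_half_line_ob.
- by move=> n; apply: gL.
Qed.

Lemma nonneg_integral_ge0 (i : interval R) g : nonneg_measurable g ->
  [set` i] `<=` `]0%R, +oo[%classic -> 0 <= \int[mu]_(x in [set` i]) (g x)%:E.
Proof.
by move=> gm iD; apply: integral_ge0; exact: (nonneg_measurable_on iD gm).2.
Qed.

Lemma nonneg_integral_sub (i j : interval R) g : nonneg_measurable g ->
  [set` i] `<=` [set` j] -> [set` j] `<=` `]0%R, +oo[%classic ->
  \int[mu]_(x in [set` i]) (g x)%:E <= \int[mu]_(x in [set` j]) (g x)%:E.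
Proof.
move=> gm ij jD; have [mg g0] := nonneg_measurable_on jD gm.
exact: ge0_subset_integral.
Qed.

Lemma nonneg_integral_le (i : interval R) g h :
  nonneg_measurable g -> nonneg_measurable h ->
  [set` i] `<=` `]0%R, +oo[%classic ->
  (forall x, x \in i -> (g x <= h x)%R) ->
  \int[mu]_(x in [set` i]) (g x)%:E <= \int[mu]_(x in [set` i]) (h x)%:E.
Proof.
move=> gm hm iD gh.
have [mg g0] := nonneg_measurable_on iD gm.
have [mh h0] := nonneg_measurable_on iD hm.
by apply: ge0_le_integral => // x xi; rewrite lee_fin; exact: gh.
Qed.

Lemma nonneg_integralZl (i : interval R) g k : nonneg_measurable g -> (0 <= k)%R ->
  [set` i] `<=` `]0%R, +oo[%classic ->
  \int[mu]_(x in [set` i]) (k * g x)%:E = k%:E * \int[mu]_(x in [set` i]) (g x)%:E.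
Proof.
move=> gm k0 iD; have [mg g0] := nonneg_measurable_on iD gm.
by under eq_integral do rewrite EFinM; rewrite ge0_integralZl_EFin.
Qed.

Lemma nonneg_measurable_cst k : (0 <= k)%R -> nonneg_measurable (fun _ => k).
Proof. by move=> k0; split => //; exact: measurable_cst. Qed.

Lemma nonneg_integral_leZ (i : interval R) g h k :
  nonneg_measurable g -> nonneg_measurable h -> (0 <= k)%R ->
  [set` i] `<=` `]0%R, +oo[%classic ->
  (forall x, x \in i -> (g x <= k)%R) ->
  \int[mu]_(x in [set` i]) (g x * h x)%:E <= k%:E * \int[mu]_(x in [set` i]) (h x)%:E.
Proof.
move=> gm hm k0 iD gk; rewrite -nonneg_integralZl//.
apply: nonneg_integral_le => //; first exact: nonneg_measurableM.
  by apply: nonneg_measurableM => //; exact: nonneg_measurable_cst.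
move=> x xi; apply: ler_wpM2r; last exact: gk.
by apply: (proj2 hm); apply: sub_half_line xi.
Qed.

Lemma nonneg_integral_geZ (i : interval R) g h k :
  nonneg_measurable g -> nonneg_measurable h -> (0 <= k)%R ->
  [set` i] `<=` `]0%R, +oo[%classic ->
  (forall x, x \in i -> (k <= g x)%R) ->
  k%:E * \int[mu]_(x in [set` i]) (h x)%:E <= \int[mu]_(x in [set` i]) (g x * h x)%:E.
Proof.
move=> gm hm k0 iD gk; rewrite -nonneg_integralZl//.
apply: nonneg_integral_le => //; last 2 first.
- exact: nonneg_measurableM.
- move=> x xi; apply: ler_wpM2r; last exact: gk.
  by apply: (proj2 hm); apply: sub_half_line xi.
by apply: nonneg_measurableM => //; exact: nonneg_measurable_cst.
Qed.

End half_line.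

(** * Primitives of weights *)

Section primitives.
Context {R : realType}.
Notation mu := (@lebesgue_measure R).
Implicit Types (f g h v : R -> R) (a b c k s x y : R).

Lemma primitive_le0 v x : (x <= 0)%R -> primitive v x = 0.
Proof.
by move=> x0; rewrite /primitive set_itv_ge ?integral_set0// bnd_simp -leNgt.
Qed.

Lemma primitive_split v a b : nonneg_measurable v -> (0 < a)%R -> (a <= b)%R ->
  primitive v b = primitive v a + \int[mu]_(s in `[a, b[) (v s)%:E.
Proof.
move=> vm a0 ab; rewrite /primitive.
by rewrite (nonneg_integral_split (l := BRight 0%R) vm _ _ ab) ?bnd_simp.
Qed.

Lemma primitive_ge0 v x : nonneg_measurable v -> 0 <= primitive v x.
Proof.
by move=> vm; apply: nonneg_integral_ge0 => //; exact: sub_half_line_ob.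
Qed.

Lemma le_primitive v a b : nonneg_measurable v -> (a <= b)%R ->
  primitive v a <= primitive v b.
Proof.
move=> vm ab; apply: nonneg_integral_sub => //; last exact: sub_half_line_ob.
by move=> x/=; rewrite !in_itv/= => /andP[-> xa]; rewrite (lt_le_trans xa).
Qed.

(** Local integrability makes the integral over [[s, t]] finite for [0 < s]. Only the behaviour near
    the origin can make the primitive infinite, and then it is infinite at every positive point. *)
Lemma primitive_finite_or_infinite v : weight v ->
  (forall t, primitive v t < +oo) \/ (forall t : R, (0 < t)%R -> primitive v t = +oo).
Proof.
move=> wv; have vm := weight_nonneg_measurable wv.
have [[t /eqP vt]|vt] := pselect (exists t, primitive v t == +oo); last first.
  left => t; rewrite ltey; apply/negP => tE; apply: vt; exists t; exact: tE.
right => s s0; have [ts|st] := leP t s.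
  by apply/eqP; rewrite -leye_eq -vt; exact: le_primitive.
have st_fin : \int[mu]_(x in `[s, t[) (v x)%:E < +oo.
  apply: (@le_lt_trans _ _ (\int[mu]_(x in `[s, t]) `|v x|%:E)).
    have -> : \int[mu]_(x in `[s, t]) `|v x|%:E = \int[mu]_(x in `[s, t]) (v x)%:E.
      apply: eq_integral => x; rewrite inE/= in_itv/= => /andP[sx _].
      by rewrite ger0_norm// (proj2 vm)// (lt_le_trans s0).
    apply: nonneg_integral_sub => //; last exact: sub_half_line_cb.
    by move=> x/=; rewrite !in_itv/= => /andP[->] /ltW.
  case: wv => [[_ _ loc] _]; apply: loc; last exact: segment_compact.
  exact: sub_half_line_cb.
move: vt; rewrite (primitive_split vm s0 (ltW st)) => vt.
move: vt st_fin; case: (primitive v s) (primitive_ge0 s vm) => [r||]//= _.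
by case: integral.
Qed.

(** * Real-valued primitives: continuity, intermediate values and level points *)

Section finite_primitive.
Variables (v V : R -> R).
Hypotheses (vm : nonneg_measurable v) (VE : forall t, primitive v t = (V t)%:E).

Lemma finite_primitive_le0 x : (x <= 0)%R -> V x = 0%R.
Proof. by move=> x0; apply: EFin_inj; rewrite -VE primitive_le0. Qed.

Lemma finite_primitive_ge0 x : (0 <= V x)%R.
Proof. by rewrite -lee_fin -VE primitive_ge0. Qed.

Lemma finite_primitive_nd : {homo V : x y / (x <= y)%R}.
Proof. by move=> x y xy; rewrite -lee_fin -!VE le_primitive. Qed.

Lemma finite_primitive_integral a b : (0 < a)%R -> (a <= b)%R ->
  \int[mu]_(s in `[a, b[) (v s)%:E = (V b - V a)%:E.
Proof.
move=> a0 ab; have := primitive_split vm a0 ab; rewrite !VE.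
by case: integral => [r||]//= [VbE]; congr EFin; lra.
Qed.

(** Endpoints are null, so [V] is the parameterized integral of [v] over [[0, x]]; finiteness of
    [V b] makes [v] integrable up to the origin. *)
Lemma finite_primitive_continuous b : (0 <= b)%R -> {within `[0%R, b], continuous V}.
Proof.
move=> b0.
have mv x : measurable_fun `]0%R, x[ v.
  by apply: measurable_funS (proj1 vm) => //; exact: sub_half_line_ob.
have VEc x : \int[mu]_(s in `[0%R, x]) (v s)%:E = (V x)%:E.
  rewrite -VE /primitive (@integral_itv_bndoo _ 0%R x)//.
  exact/measurable_EFinP.
have vi : mu.-integrable `[0%R, b] (EFin \o v).
  apply/integrableP; split.
    by apply/measurable_EFinP; exact: measurable_fun_itv_cc (mv b).
  have mab : measurable_fun `]0%R, b[ (fun x => `|v x|%R).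
    by apply: measurableT_comp => //; exact: mv.
  rewrite (_ : \int[mu]_(x in _) _ = (V b)%:E) ?ltry//.
  rewrite -VEc; apply: eq_integral_itv_bounded => //.
  by move=> x; rewrite in_itv/= => /andP[x0 _]; rewrite ger0_norm// (proj2 vm).
have <- : (fun x => parameterized_integral mu 0%R x v) = V.
  by apply/funext => x; exact: (congr1 fine (VEc x)).
exact: parameterized_integral_continuous.
Qed.

Lemma finite_primitive_onto b c : (0 <= b)%R -> (0 <= c <= V b)%R ->
  exists2 t, (0 <= t <= b)%R & V t = c.
Proof.
move=> b0 /andP[c0 cb].
have V0 : V 0%R = 0%R by exact: finite_primitive_le0.
have := IVT b0 (finite_primitive_continuous b0) (v := c).
rewrite V0 min_l ?max_r ?finite_primitive_ge0// c0 cb => /(_ isT)[t].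
by rewrite in_itv/= => tb <-; exists t.
Qed.

Lemma finite_primitive_lt x y : (V x < V y)%R -> (x < y)%R.
Proof. by apply: contraTT; rewrite -!leNgt; exact: finite_primitive_nd. Qed.

Lemma finite_primitive_pos x : (0 < V x)%R -> (0 < x)%R.
Proof.
by apply: contraTT; rewrite -!leNgt => x0; rewrite finite_primitive_le0.
Qed.

Lemma exprn_unbounded (M c : R) : (1 < M)%R -> exists n, (c < M ^+ n)%R.
Proof.
(* Bernoulli's inequality. *)
move=> M1; have bern n : (1 + n%:R * (M - 1) <= M ^+ n)%R.
  elim: n => [|n IH]; first by rewrite mul0r addr0 expr0.
  rewrite exprS -natr1; have n0 : (0 <= n%:R :> R)%R by exact: ler0n.
  have := mulr_ge0 n0 (sqr_ge0 (M - 1)); rewrite expr2.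
  have M0 : (0 <= M)%R by exact: le_trans (ltW M1).
  have := ler_wpM2l M0 IH; lra.
exists (Num.truncn (c / (M - 1))).+1; apply: lt_le_trans (bern _).
have : (c / (M - 1) < (Num.truncn (c / (M - 1))).+1%:R)%R by exact: truncnS_gt.
by rewrite ltr_pdivrMr ?subr_gt0// => /lt_trans; apply; rewrite ltrDr.
Qed.

(** Continuity supplies a point at each level, and monotonicity of [V] orders points of decreasing
    level. By the last clause, if [V] is positive on the half-line then the ladder exhausts []0,
    x[]. *)
Lemma geometric_levels (M : R) x : (1 < M)%R -> (0 < V x)%R ->
  exists t : nat -> R, [/\ t 0%N = x,
    forall n, V (t n) = (V x / M ^+ n)%R,
    forall n, (0 < t n)%R,
    forall n, (t n.+1 < t n)%R &
    forall a, (0 < V a)%R -> exists n, (t n < a)%R].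
Proof.
move=> M1 Vx; have M0 : (0 < M)%R by exact: lt_trans M1.
have Mn0 n : (0 < M ^+ n)%R by exact: exprn_gt0.
have x0 := finite_primitive_pos Vx.
have ex n : exists s, V s = (V x / M ^+ n)%R.
  have [s _ sE] : exists2 s, (0 <= s <= x)%R & V s = (V x / M ^+ n)%R.
    apply: finite_primitive_onto; first exact: ltW.
    apply/andP; split; first by rewrite divr_ge0 ?ltW.
    by rewrite ler_pdivrMr// ler_peMr ?exprn_ege1// ltW.
  by exists s.
have [t tE] := choice ex.
(* [V] may be flat, so the point chosen at level [V x] need not be [x]; index 0 is reset to [x]. *)
pose t' n := if n is 0%N then x else t n.
have t'E n : V (t' n) = (V x / M ^+ n)%R.
  by case: n => [|n]/=; rewrite ?expr0 ?divr1.
exists t'; split => //.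
- by move=> n; apply: finite_primitive_pos; rewrite t'E divr_gt0.
- move=> n; apply: finite_primitive_lt; rewrite !t'E exprS invfM mulrA mulrAC.
  by rewrite ltr_pdivrMr// ltr_pMr// divr_gt0.
- move=> a Va.
  have [n nP] := exprn_unbounded (V x / V a) M1.
  exists n; apply: finite_primitive_lt; rewrite t'E.
  by rewrite ltr_pdivrMr// mulrC -ltr_pdivrMr.
Qed.

End finite_primitive.
End primitives.

(** * Essential suprema over the half-line *)

Section essential_suprema.
Context {R : realType}.
Notation mu := (@lebesgue_measure R).
Implicit Types (f u w : R -> R) (c k s x y : R).

Lemma lebesgue_ae_mono (P Q : R -> Prop) : (forall s, P s -> Q s) ->
  (\forall s \ae mu, P s) -> \forall s \ae mu, Q s.
Proof. by move=> PQ; apply: (@filterS _ _ (ae_filter_ringOfSetsType mu)). Qed.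

Lemma lebesgue_aeT (P : R -> Prop) : (forall s, P s) -> \forall s \ae mu, P s.
Proof.
move=> PT; exists set0; split; rewrite ?measure0//.
by move=> s/= nPs; case: nPs.
Qed.

(** The restricted measure ignores the complement of the half-line: an exceptional set is
    intersected with the half-line in one direction and enlarged by the complement in the other. *)
Lemma ess_sup_onP (g : R -> \bar R) (y : \bar R) :
  ess_sup_on `]0%R, +oo[ g <= y <->
  \forall s \ae mu, (0 < s)%R -> g s <= y.
Proof.
have mD : measurable (`]0%R, +oo[%classic : set R) by exact: measurable_itv.
rewrite /ess_sup_on; split.
  move=> /ess_supP[N [mN N0 gN]]; exists (N `&` `]0%R, +oo[); split => //.
    exact: measurableI.
  move=> s/= /not_implyP[s0 gs]; split; first exact: gN.
  by rewrite /= in_itv/= s0.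
move=> [N [mN N0 gN]]; apply/ess_supP.
exists (N `|` ~` `]0%R, +oo[); split.
- by apply: measurableU => //; exact: measurableC.
- rewrite /= /mrestr setIUl setICl setU0.
  by apply/eqP; rewrite -measure_le0 -N0 le_measure ?inE//; exact: measurableI.
- move=> s/= gs; have [s0|s0] := ltP 0%R s.
    by left; apply: gN => /= /(_ s0).
  by right; rewrite /= in_itv/= andbT; apply/negP; rewrite -leNgt.
Qed.

(** A negative essential supremum would place []0, 1[] inside a null set. *)
Lemma ess_sup_on_ge0 (g : R -> \bar R) : (forall s, (0 < s)%R -> 0 <= g s) ->
  0 <= ess_sup_on `]0%R, +oo[ g.
Proof.
move=> g0; rewrite leNgt; apply/negP => gneg.
have /ess_sup_onP[N [mN N0 gN]] := lexx (ess_sup_on `]0%R, +oo[ g).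
have : mu (`]0%R, 1%R[%classic : set R) <= mu N.
  apply: le_measure; rewrite ?inE//.
  move=> s/=; rewrite in_itv/= => /andP[s0 _]; apply: gN => /= gs.
  by have := lt_le_trans gneg (le_trans (g0 s s0) (gs s0)); rewrite ltxx.
by rewrite N0 lebesgue_measure_itv/= lte_fin ltr01 oppr0 adde0 lee_fin ler10.
Qed.

(** The factor may be 0 or [+oo]. For [k = 0] the claim is [0 <= K], which rests on the half-line
    not being null; for [k = +oo] a value [K] other than [+oo] forces [g] to vanish almost
    everywhere there. *)
Lemma ess_sup_on_mulr_le (g : R -> \bar R) (k K : \bar R) : 0 <= k ->
  (forall s, (0 < s)%R -> 0 <= g s) ->
  (\forall s \ae mu, (0 < s)%R -> g s * k <= K) ->
  ess_sup_on `]0%R, +oo[ g * k <= K.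
Proof.
move=> k0 g0 gK.
have K0 : 0 <= K.
  have : ess_sup_on `]0%R, +oo[ (fun s => g s * k) <= K by apply/ess_sup_onP.
  apply: le_trans; apply: ess_sup_on_ge0 => s s0; by apply: mule_ge0 => //; exact: g0.
have [k_eq0|kn0] := eqVneq k 0; first by rewrite k_eq0 mule0.
have kpos : 0 < k by rewrite lt_def kn0.
case: k k0 gK kn0 kpos => [k||]// _ gK _ kpos.
- rewrite -lee_pdivlMr//; apply/ess_sup_onP.
  by apply: lebesgue_ae_mono gK => s gs s0; rewrite lee_pdivlMr// gs.
- have [->|Kfin] := eqVneq K +oo; first exact: leey.
  have : ess_sup_on `]0%R, +oo[ g <= 0.
    apply/ess_sup_onP; apply: lebesgue_ae_mono gK => s gs s0.
    rewrite leNgt; apply/negP => gpos; have := gs s0.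
    by rewrite gt0_muley// leye_eq (negbTE Kfin).
  move=> A0; have -> : ess_sup_on `]0%R, +oo[ g = 0.
    by apply/eqP; rewrite eq_le A0 ess_sup_on_ge0.
  by rewrite mul0e.
Qed.

Lemma ess_sup_on_mulr_ae (g : R -> \bar R) (k K : \bar R) : 0 <= k ->
  ess_sup_on `]0%R, +oo[ g * k <= K ->
  \forall s \ae mu, (0 < s)%R -> g s * k <= K.
Proof.
move=> k0 gK; have /ess_sup_onP := lexx (ess_sup_on `]0%R, +oo[ g).
by apply: lebesgue_ae_mono => s gs s0; apply: le_trans gK; by apply: lee_wpmul2r => //; exact: gs.
Qed.

Lemma inve_EFin_pos x : (0 < x)%R -> (x%:E)^-1 = (x^-1)%:E.
Proof. by move=> x0; rewrite inver gt_eqF. Qed.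

(** * The averaging inequality compared with its bounds at each [x] *)

Section weighted_averages.
Variables (u w U : R -> R).
Hypotheses (wu : weight u) (ww : weight w).
Hypotheses (UE : forall t, primitive u t = (U t)%:E).
Hypothesis (U0 : forall t : R, (0 < t)%R -> (0 < U t)%R).

Let um := weight_nonneg_measurable wu.

(** The function [A] of the opening overview; [head_integral] is its [I]. *)
Definition weight_sup x : \bar R :=
  ess_sup_on `]0%R, +oo[ (fun s => (w s)%:E * calU (primitive u) x s).

Definition head_integral f x : \bar R :=
  \int[mu]_(t in `]0%R, x[) (f t * u t)%:E.

Lemma calUE x s : (0 < x)%R -> (0 < s)%R ->
  calU (primitive u) x s = (U x / (U s + U x))%:E.
Proof.
by move=> x0 s0; rewrite /calU !UE -EFinD inve_EFin_pos// addr_gt0 ?U0.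
Qed.

Lemma weight_sup_ge0 x : (0 < x)%R -> 0 <= weight_sup x.
Proof.
move=> x0; apply: ess_sup_on_ge0 => s s0; rewrite calUE// -EFinM lee_fin.
by rewrite mulr_ge0 ?(proj2 ww)// divr_ge0 ?addr_ge0// ltW// U0.
Qed.

Lemma head_integral_ge0 f x : nonneg_measurable f -> 0 <= head_integral f x.
Proof.
move=> fm; apply: nonneg_integral_ge0; first exact: nonneg_measurableM.
exact: sub_half_line_ob.
Qed.

Lemma le_head_integral f x y : nonneg_measurable f -> (x <= y)%R ->
  head_integral f x <= head_integral f y.
Proof.
by move=> fm xy; apply: (le_primitive (nonneg_measurableM fm um) xy).
Qed.

(** Either [s + 1] already qualifies, or continuity of [U] attains the value [2 * U s] before it. *)
Lemma doubling_point s : (0 < s)%R ->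
  exists2 x, (s < x)%R & (U x <= 2 * U s)%R.
Proof.
move=> s0; have [h|h] := leP (U (s + 1)%R) (2 * U s)%R.
  by exists (s + 1)%R => //; rewrite ltrDl.
have s10 : (0 <= s + 1)%R by rewrite addr_ge0// ltW.
have [|x _ xE] := finite_primitive_onto um UE (c := (2 * U s)%R) s10.
  by rewrite (ltW h) andbT mulr_ge0// ltW// U0.
exists x; last by rewrite xE.
by apply: (finite_primitive_lt um UE); rewrite xE ltr_pMl ?U0// ltr1n.
Qed.

Lemma halving_point s : (0 < s)%R ->
  exists x, [/\ (0 < x)%R, (x < s)%R & (U s <= 2 * U x)%R].
Proof.
move=> s0; have Us := U0 s0.
have [|x _ xE] := finite_primitive_onto um UE (c := (U s / 2)%R) (ltW s0).
  by apply/andP; split; lra.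
exists x; split.
- by apply: (finite_primitive_pos UE); rewrite xE divr_gt0.
- by apply: (finite_primitive_lt um UE); rewrite xE; lra.
- by rewrite xE; lra.
Qed.

(** Each [x] has its own exceptional null set. Restricting to rational [x] leaves a single one, and
    continuity of [U] lets a rational point slightly above [s] stand in for [s]. *)
Lemma hardy_lhs_le f (K : \bar R) : nonneg_measurable f ->
  (forall x, (0 < x)%R ->
    weight_sup x * (primitive u x)^-1 * head_integral f x <= K) ->
  hardy_lhs u w f <= 3%:E * K.
Proof.
move=> fm AK; apply/ess_sup_onP.
have AKq (q : rat) : \forall s \ae mu, (0 < s)%R -> (0 < ratr q :> R)%R ->
    (w s)%:E * calU (primitive u) (ratr q) s *
    ((primitive u (ratr q))^-1 * head_integral f (ratr q)) <= K.
  have [q0|q0] := ltP 0%R (ratr q : R); last by apply: lebesgue_aeT => s _.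
  have k0 : 0 <= (primitive u (ratr q))^-1 * head_integral f (ratr q).
    by rewrite mule_ge0 ?head_integral_ge0// UE inve_EFin_pos ?U0// lee_fin invr_ge0 ltW ?U0.
  have := AK _ q0; rewrite -muleA => /(ess_sup_on_mulr_ae k0).
  by apply: lebesgue_ae_mono => s h s0 _; exact: h.
have : \forall s \ae mu, forall q : rat, (0 < s)%R -> (0 < ratr q :> R)%R ->
    (w s)%:E * calU (primitive u) (ratr q) s *
    ((primitive u (ratr q))^-1 * head_integral f (ratr q)) <= K.
  (* Enumerating the rationals through [pickle] reduces this to a countable intersection of
     conditions, each valid almost everywhere. *)
  have : \forall s \ae mu, forall (n : nat) (q : rat),
      unpickle n = Some q -> (0 < s)%R -> (0 < ratr q :> R)%R ->
    (w s)%:E * calU (primitive u) (ratr q) s *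
    ((primitive u (ratr q))^-1 * head_integral f (ratr q)) <= K.
    apply: ae_foralln => n; case: (unpickle n) => [q|]; last exact: lebesgue_aeT.
    by have := AKq q; apply: lebesgue_ae_mono => s h _ [<-].
  by apply: lebesgue_ae_mono => s h q; apply: (h (pickle q)); rewrite pickleK.
apply: lebesgue_ae_mono => s h s0.
have [y sy Uy] := doubling_point s0.
have [q] := rat_in_itvoo sy; rewrite in_itv/= => /andP[sq qy].
have q0 : (0 < ratr q :> R)%R by exact: lt_trans sq.
have Uq := U0 q0; have Us := U0 s0; have ws := proj2 ww s s0.
have Uqy : (U (ratr q) <= U y)%R by apply: (finite_primitive_nd um UE); exact: ltW.
have {h} := h q s0 q0.
rewrite calUE// !UE !inve_EFin_pos// muleA -!EFinM => hK.
(* Writing [q] for [ratr q], the factor 3 comes from [U s + U q <= 3 * U s], valid since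
   [U q <= U y <= 2 * U s]. *)
apply: (@le_trans _ _ ((3 * (w s * (U (ratr q) / (U s + U (ratr q))) / U (ratr q)))%:E
   * head_integral f (ratr q))).
  apply: lee_pmul.
  - by rewrite lee_fin mulr_ge0// invr_ge0 ltW.
  - exact: head_integral_ge0.
  - rewrite lee_fin.
    have -> : (3 * (w s * (U (ratr q) / (U s + U (ratr q))) / U (ratr q)))%R
            = (w s * (3 / (U s + U (ratr q))))%R.
      by field; rewrite !gt_eqF ?addr_gt0.
    apply: ler_wpM2l => //; rewrite ler_pdivlMr ?addr_gt0// mulrC ler_pdivrMr//.
    lra.
  - by apply: le_head_integral => //; exact: ltW.
by rewrite EFinM -muleA; apply: lee_wpmul2l.
Qed.

(** For fixed [s] the claim amounts to [U s * I x <= (U s + U x) * I s]. For [x <= s] monotonicity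
    of [I] suffices; for [s < x] the part of [I x] beyond [s] is compared with [I s] through the
    monotonicity of [f]. *)
Lemma weight_sup_head_integral_le f (K : \bar R) x : nonneg_nonincreasing f ->
  hardy_lhs u w f <= K -> (0 < x)%R ->
  weight_sup x * (primitive u x)^-1 * head_integral f x <= K.
Proof.
move=> fn fK x0; have fm := nonneg_nonincreasing_measurable fn.
have Ux := U0 x0.
rewrite -muleA; apply: ess_sup_on_mulr_le.
- by rewrite mule_ge0 ?head_integral_ge0// UE inve_EFin_pos// lee_fin invr_ge0 ltW.
- move=> s s0; rewrite calUE// -EFinM lee_fin.
  by rewrite mulr_ge0 ?(proj2 ww)// divr_ge0 ?addr_ge0// ltW// U0.
move: fK => /ess_sup_onP; apply: lebesgue_ae_mono => s h s0.
apply: le_trans (h s0); have Us := U0 s0; have ws := proj2 ww s s0.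
rewrite calUE// !UE !inve_EFin_pos// muleA -!EFinM.
have -> : (w s * (U x / (U s + U x)) / U x = w s / U s * (U s / (U s + U x)))%R.
  by field; rewrite !gt_eqF ?addr_gt0.
rewrite [X in X * head_integral _ _]EFinM -[leLHS]muleA; apply: lee_wpmul2l.
  by rewrite lee_fin divr_ge0// ltW.
have -> : (U s / (U s + U x))%:E = ((U s + U x)^-1)%:E * (U s)%:E.
  by rewrite -EFinM mulrC.
rewrite -muleA lee_pdivrMl ?addr_gt0//.
have [xs|sx] := leP x s.
  apply: lee_pmul; rewrite ?lee_fin ?(ltW Us) ?head_integral_ge0//.
    by rewrite lerDl ltW.
  exact: le_head_integral.
(* [U s * int_s^x f u <= U s * f s * U x <= U x * int_0^s f u] *)
have fs0 : (0 <= f s)%R by case: fn => _ + _; apply.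
have -> : head_integral f x = head_integral f s + \int[mu]_(t in `[s, x[) (f t * u t)%:E.
  by apply: (primitive_split (nonneg_measurableM fm um)) => //; exact: ltW.
rewrite EFinD ge0_muleDl ?lee_fin ?(ltW Us) ?(ltW Ux)//.
rewrite ge0_muleDr ?head_integral_ge0//; last first.
  apply: nonneg_integral_ge0; first exact: nonneg_measurableM.
  exact: sub_half_line_cb.
rewrite leeD2l//.
have h1 : \int[mu]_(t in `[s, x[) (f t * u t)%:E <= (f s)%:E * (U x)%:E.
  apply: (@le_trans _ _ ((f s)%:E * \int[mu]_(t in `[s, x[) (u t)%:E)).
    apply: nonneg_integral_leZ => //; first exact: sub_half_line_cb.
    by move=> t; rewrite in_itv/= => /andP[st _]; case: fn => _ _; apply.
  apply: lee_wpmul2l; first by rewrite lee_fin.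
  rewrite (finite_primitive_integral um UE)// ?(ltW sx)// lee_fin.
  by rewrite gerBl ltW.
have h2 : (f s)%:E * (U s)%:E <= head_integral f s.
  rewrite -UE; apply: nonneg_integral_geZ => //; first exact: sub_half_line_ob.
  move=> t; rewrite in_itv/= => /andP[t0 ts]; case: fn => _ _; apply => //.
  exact: ltW.
apply: (@le_trans _ _ ((U s)%:E * ((f s)%:E * (U x)%:E))).
  by apply: lee_wpmul2l => //; rewrite lee_fin ltW.
rewrite muleA muleC [(U s)%:E * _]muleC; apply: lee_wpmul2l => //.
by rewrite lee_fin ltW.
Qed.

End weighted_averages.
End essential_suprema.

(** * Finite power inequalities: subadditivity, Hoelder, discrete Hardy *)

Section finite_sums.
Context {R : realType}.
Implicit Types (p q r s x y : R) (a b W : nat -> R).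
Local Open Scope ring_scope.

(** Each share [z / (x + y)] is at most 1, hence at most its own [p]-th power because [p <= 1]; the
    two shares add up to 1. *)
Lemma powR_subadditive p x y : 0 < p -> p <= 1 -> 0 <= x -> 0 <= y ->
  (x + y) `^ p <= x `^ p + y `^ p.
Proof.
move=> p0 p1 x0 y0; have [xy0|xyn0] := eqVneq (x + y) 0.
  by rewrite xy0 powR0 ?gt_eqF// addr_ge0 ?powR_ge0.
have xy : 0 < x + y by rewrite lt_def xyn0 addr_ge0.
have frac z : 0 <= z -> z <= x + y -> (z / (x + y)) * (x + y) `^ p <= z `^ p.
  move=> z0 zxy; have [->|zn0] := eqVneq z 0; first by rewrite !mul0r powR_ge0.
  have zE : z = (z / (x + y)) * (x + y) by rewrite divfK.
  rewrite [X in _ <= X `^ p]zE powRM ?divr_ge0 ?(ltW xy)//.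
  apply: ler_wpM2r; first exact: powR_ge0.
  apply: ger1_powR => //; rewrite divr_gt0 ?lt_def ?zn0//= ?xyn0 ?(ltW xy)//.
  by rewrite ler_pdivrMr// mul1r.
have := lerD (frac x x0 _) (frac y y0 _); rewrite lerDl lerDr -mulrDl -mulrDl divff//.
by rewrite mul1r; apply.
Qed.

Lemma powR_sum_le p a N : 0 < p -> p <= 1 -> (forall n, 0 <= a n) ->
  (\sum_(n < N) a n) `^ p <= \sum_(n < N) a n `^ p.
Proof.
move=> p0 p1 a0; elim: N => [|N IH]; first by rewrite !big_ord0 powR0 ?gt_eqF.
rewrite !big_ord_recr/=; apply: le_trans (lerD IH (lexx _)).
by apply: powR_subadditive => //; exact: sumr_ge0.
Qed.

Lemma powR_invK p x : p != 0 -> 0 <= x -> (x `^ p^-1) `^ p = x.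
Proof. by move=> p0 x0; rewrite -powRrM mulVf// powRr1. Qed.

Lemma powR_normalized p x y : 0 < p -> 0 <= x -> 0 < y ->
  (x / y `^ p^-1) `^ p = x `^ p / y.
Proof.
move=> p0 x0 y0; have yp : 0 < y `^ p^-1 by exact: powR_gt0.
rewrite -[x in RHS](divfK (lt0r_neq0 yp)) [in RHS]powRM ?divr_ge0 ?(ltW yp)//.
by rewrite powR_invK ?gt_eqF ?(ltW y0)// mulfK// gt_eqF.
Qed.

(** Young's inequality for [x] and [y] divided by the roots of [s] and [r]. When [s] and [r] are the
    full power sums, the brackets add up to [1/p + 1/q = 1], which is Hoelder's inequality. *)
Lemma normalized_young p q x y s r : 0 < p -> 0 < q -> p^-1 + q^-1 = 1 ->
  0 <= x -> 0 <= y -> 0 < s -> 0 < r ->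
  x * y <= s `^ p^-1 * r `^ q^-1 * (x `^ p / s / p + y `^ q / r / q).
Proof.
move=> p0 q0 pq x0 y0 s0 r0.
have sp : 0 < s `^ p^-1 by exact: powR_gt0.
have rq : 0 < r `^ q^-1 by exact: powR_gt0.
have xs : 0 <= x / s `^ p^-1 by rewrite divr_ge0// ltW.
have yr : 0 <= y / r `^ q^-1 by rewrite divr_ge0// ltW.
have := conjugate_powR xs yr p0 q0 pq; rewrite !powR_normalized//.
rewrite mulrACA -invfM ler_pdivrMr ?mulr_gt0//.
by rewrite [X in _ <= X -> _]mulrC.
Qed.

Lemma finite_hoelder p q a b N : 0 < p -> 0 < q -> p^-1 + q^-1 = 1 ->
  (forall n, 0 <= a n) -> (forall n, 0 <= b n) ->
  \sum_(n < N) a n * b n <=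
  (\sum_(n < N) a n `^ p) `^ p^-1 * (\sum_(n < N) b n `^ q) `^ q^-1.
Proof.
move=> p0 q0 pq a0 b0.
set A := \sum_(n < N) a n `^ p; set B := \sum_(n < N) b n `^ q.
have A0 : 0 <= A by apply: sumr_ge0 => n _; exact: powR_ge0.
have B0 : 0 <= B by apply: sumr_ge0 => n _; exact: powR_ge0.
(* The normalisation divides by the power sums, so a zero sum is treated apart: all its terms
   vanish. *)
have vanish (r : R) (c : nat -> R) : 0 < r -> \sum_(n < N) c n `^ r = 0 ->
    forall n : 'I_N, c n = 0.
  move=> r0 /eqP; rewrite psumr_eq0; last by move=> n _; exact: powR_ge0.
  by move=> /allP h n; have := h n (mem_index_enum n) => /= /eqP /powR_eq0_eq0.
have [A_eq0|An0] := eqVneq A 0.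
  rewrite big1 ?mulr_ge0 ?powR_ge0// => n _.
  by rewrite (vanish p a p0 A_eq0) mul0r.
have [B_eq0|Bn0] := eqVneq B 0.
  rewrite big1 ?mulr_ge0 ?powR_ge0// => n _.
  by rewrite (vanish q b q0 B_eq0) mulr0.
have Ap : 0 < A by rewrite lt_def An0.
have Bp : 0 < B by rewrite lt_def Bn0.
have Ar : 0 < A `^ p^-1 by exact: powR_gt0.
have Br : 0 < B `^ q^-1 by exact: powR_gt0.
have step (n : 'I_N) : a n * b n <=
    A `^ p^-1 * B `^ q^-1 * (a n `^ p / A / p + b n `^ q / B / q).
  exact: normalized_young.
apply: le_trans (ler_sum _ (fun n _ => step n)) _.
rewrite -mulr_sumr big_split/= -!mulr_suml divff ?divff//.
by rewrite !mul1r pq mulr1.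
Qed.

Lemma powR_add_le p x y : 0 <= p -> 0 <= x -> 0 <= y ->
  (x + y) `^ p <= 2 `^ p * (x `^ p + y `^ p).
Proof.
move=> p0 x0 y0; wlog xy : x y x0 y0 / x <= y.
  move=> h; have [/h|/ltW /h] := leP x y; first exact.
  by rewrite addrC [X in _ <= _ * X]addrC; exact.
apply: (@le_trans _ _ ((2 * y) `^ p)).
  by apply: ge0_ler_powR; rewrite ?nnegrE ?addr_ge0 ?mulr_ge0//; lra.
rewrite powRM//; apply: ler_wpM2l; first exact: powR_ge0.
by rewrite lerDr powR_ge0.
Qed.

(* With ratio [2 * 2 `^ p] each partial sum costs at most half of the previous one. *)
Lemma geometric_hardy p a W N : 0 <= p -> (forall n, 0 <= a n) ->
  (forall n, 0 <= W n) -> (forall n, W n = 2 * 2 `^ p * W n.+1) ->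
  \sum_(n < N) W n * (\sum_(k < n.+1) a k) `^ p <=
  2 * 2 `^ p * \sum_(n < N) W n * a n `^ p.
Proof.
move=> p0 a0 W0 WS; case: N => [|N]; first by rewrite !big_ord0 mulr0.
pose S n := \sum_(k < n.+1) a k.
have S0 n : 0 <= S n by exact: sumr_ge0.
(* The claim is strengthened by a second copy of the last term: in the induction that copy pays for
   the [S N] part of [S N.+1], since [W N = 2 * 2^p * W N.+1]. *)
suff : \sum_(n < N.+1) W n * S n `^ p + W N * S N `^ p <=
    2 * 2 `^ p * \sum_(n < N.+1) W n * a n `^ p.
  by apply: le_trans; rewrite lerDl mulr_ge0// powR_ge0.
have c1 : 1 <= 2 `^ p :> R.
  by have := @ler_powR R 2 (ler1n _ 2) _ _ p0; rewrite powRr0.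
elim: N => [|N IH].
  rewrite !big_ord_recr !big_ord0/= !add0r /S big_ord_recr big_ord0/= add0r.
  have Wa : 0 <= W 0%N * a 0%N `^ p by rewrite mulr_ge0// powR_ge0.
  have := ler_wpM2r Wa c1; rewrite -mulrA; move: (W 0%N * _) => z; move: (2 `^ p) => y; lra.
rewrite big_ord_recr [X in _ <= _ * X]big_ord_recr/= mulrDr.
suff : 2 * (W N.+1 * S N.+1 `^ p) <=
    W N * S N `^ p + 2 * 2 `^ p * (W N.+1 * a N.+1 `^ p) by lra.
have SS : S N.+1 = S N + a N.+1 by rewrite /S big_ord_recr.
have := ler_wpM2l (W0 N.+1) (powR_add_le p0 (S0 N) (a0 N.+1)).
rewrite -SS (WS N); lra.
Qed.

(** Since [t] decreases, the indices with [s < t n] form an initial segment. The left side is then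
    the power of one partial sum, which occurs on the right at the last index of that segment. *)
Lemma powR_step_sum_le p (t a : nat -> R) s N : 0 < p ->
  (forall n, t n.+1 <= t n) -> (forall n, 0 <= a n) ->
  (\sum_(n < N) a n * (s < t n)%R%:R) `^ p <=
  \sum_(n < N) (\sum_(k < n.+1) a k) `^ p * (s < t n)%R%:R.
Proof.
move=> p0 tS a0; elim: N => [|N IH]; first by rewrite !big_ord0 powR0 ?gt_eqF.
have [stN|tNs] := ltP s (t N); last first.
  by rewrite big_ord_recr [leRHS]big_ord_recr/= ltNge tNs/= !mulr0 !addr0.
have tN n : (n <= N)%N -> t N <= t n.
  elim: (N) => [|m IHm]; first by rewrite leqn0 => /eqP ->.
  rewrite leq_eqVlt => /predU1P[-> //|nm]; exact: le_trans (tS m) (IHm nm).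
rewrite [leRHS]big_ord_recr/= stN mulr1.
have -> : \sum_(n < N.+1) a n * (s < t n)%R%:R = \sum_(n < N.+1) a n.
  by apply: eq_bigr => n _; rewrite (lt_le_trans stN) ?mulr1// tN// -ltnS.
rewrite lerDr; apply: sumr_ge0 => n _; rewrite mulr_ge0 ?powR_ge0//.
Qed.

End finite_sums.

(** * Truncation by indicators, written as Booleans cast to numbers *)

Section truncation.
Context {R : realType}.
Notation mu := (@lebesgue_measure R).
Implicit Types (g : R -> R) (t y : R).

Lemma nonneg_measurable_below t : nonneg_measurable (fun s : R => (s < t)%R%:R).
Proof.
split; last by move=> s _; exact: ler0n.
rewrite (_ : (fun s : R => _) = \1_(`]-oo, t[%classic : set R)).
  by apply: measurable_indic; exact: measurable_itv.
by apply/funext => s; rewrite indicE mem_setE in_itv.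
Qed.

Lemma integral_below (D : set R) t g :
  \int[mu]_(s in D) ((s < t)%R%:R * g s)%:E =
  \int[mu]_(s in D `&` `]-oo, t[) (g s)%:E.
Proof.
rewrite integral_mkcondr; apply: eq_integral => s _.
by rewrite patchE mem_setE in_itv/=; case: ifPn => _; rewrite ?mul1r ?mul0r.
Qed.

Lemma primitive_below t y g :
  primitive (fun s => (s < t)%R%:R * g s)%R y = primitive g (Num.min t y).
Proof.
rewrite /primitive integral_below; congr (integral _ _ _).
apply/seteqP; split => s/=; rewrite !in_itv/= lt_min.
  by move=> [/andP[-> ->] ->].
by move=> /andP[-> /andP[-> ->]].
Qed.

Lemma half_line_integral_below t g :
  \int[mu]_(s in `]0%R, +oo[) ((s < t)%R%:R * g s)%:E = primitive g t.
Proof.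
rewrite /primitive integral_below; congr (integral _ _ _).
apply/seteqP; split => s/=; rewrite !in_itv/= andbT; first by move=> [-> ->].
by move=> /andP.
Qed.

End truncation.

(** * Estimates along ladders of level points *)

Section ladders.
Context {R : realType}.
Notation mu := (@lebesgue_measure R).
Implicit Types (f g u v : R -> R) (p x y : R).
Variables (v V : R -> R).
Hypotheses (vm : nonneg_measurable v) (VE : forall t, primitive v t = (V t)%:E).
Variable t : nat -> R.
Hypotheses (t0 : forall n, (0 < t n)%R) (tS : forall n, (t n.+1 < t n)%R).

(** The factor 4 comes from [V (t n) = 4 * (V (t n.+1) - V (t n.+2))]; on the block [[t n.+2, t
    n.+1[] the function [f] is at least [f (t n.+1)], and these blocks are disjoint. *)
Lemma ladder_weighted_norm_le p f N : (0 <= p)%R -> nonneg_nonincreasing f ->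
  (forall n, V (t n) = (2 * V (t n.+1))%R) ->
  (\sum_(n < N) f (t n.+1) `^ p * V (t n))%:E <=
  4%:E * \int[mu]_(x in `]0%R, +oo[) (f x `^ p * v x)%:E.
Proof.
move=> p0 fn Vt.
have fpm := nonneg_measurable_powR p (nonneg_nonincreasing_measurable fn).
have fm := nonneg_measurableM fpm vm.
case: fn => _ f0 fni.
pose t' n := t n.+1.
apply: (@le_trans _ _ (4%:E * \int[mu]_(x in `[t' N, t' 0%N[) (f x `^ p * v x)%:E)); last first.
  apply: lee_wpmul2l; first by rewrite lee_fin.
  by apply: nonneg_integral_sub => //; exact: sub_half_line_cb (t0 _).
rewrite (ladder_integral (t := t') _ fm) => [|n|n]; [|exact: t0|exact/ltW/tS].
rewrite ge0_sume_distrr; last first.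
  by move=> n _; apply: nonneg_integral_ge0 => //; exact: sub_half_line_cb (t0 _).
rewrite -sumEFin; apply: lee_sum => n _.
apply: (@le_trans _ _ (4%:E * ((f (t n.+1) `^ p)%:E * \int[mu]_(x in `[t n.+2, t n.+1[) (v x)%:E))).
  rewrite (finite_primitive_integral vm VE) ?(ltW (tS _))// -!EFinM lee_fin.
  rewrite (Vt n) (Vt n.+1); set a := (_ `^ _)%R; set b := V _; lra.
apply: lee_wpmul2l; first by rewrite lee_fin.
apply: nonneg_integral_geZ => //; [exact: powR_ge0|exact: sub_half_line_cb (t0 _)|].
move=> s; rewrite in_itv/= => /andP[ts st]; have s0 := lt_le_trans (t0 _) ts.
by apply: ge0_ler_powR; rewrite ?nnegrE ?f0 ?fni// ltW.
Qed.

(** On each block [f] is at most its value at the left endpoint. The function [g] is generic, to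
    stand for [u] or for a truncation of [u]. *)
Lemma ladder_head_integral_le f g N : nonneg_nonincreasing f ->
  nonneg_measurable g ->
  \int[mu]_(s in `[t N, t 0%N[) (f s * g s)%:E <=
  \sum_(n < N) (f (t n.+1))%:E * primitive g (t n).
Proof.
move=> fn gm; have fm := nonneg_nonincreasing_measurable fn.
rewrite (ladder_integral N (nonneg_measurableM fm gm) t0) => [|n]; last exact/ltW/tS.
apply: lee_sum => n _; case: fn => _ f0 fni.
apply: (@le_trans _ _ ((f (t n.+1))%:E * \int[mu]_(s in `[t n.+1, t n[) (g s)%:E)).
  apply: nonneg_integral_leZ => //; rewrite ?f0//; first exact: sub_half_line_cb.
  by move=> s; rewrite in_itv/= => /andP[ts _]; apply: fni.
apply: lee_wpmul2l; first by rewrite lee_fin f0.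
apply: nonneg_integral_sub => //; last exact: sub_half_line_ob.
by move=> s/=; rewrite !in_itv/= => /andP[ts ->]; rewrite (lt_le_trans _ ts).
Qed.

End ladders.

(** * Head integrals for [p <= 1], and the dual integrand *)

Section finite_weight_estimates.
Context {R : realType}.
Notation mu := (@lebesgue_measure R).
Variables (u v U V : R -> R).
Hypotheses (um : nonneg_measurable u) (vm : nonneg_measurable v).
Hypotheses (UE : forall t, primitive u t = (U t)%:E).
Hypotheses (VE : forall t, primitive v t = (V t)%:E).
Hypothesis (U0 : forall t : R, (0 < t)%R -> (0 < U t)%R).
Hypothesis (V0 : forall t : R, (0 < t)%R -> (0 < V t)%R).

(** Along the ladder from [x] the hypothesis trades [U (t k)] for [e * V (t k)^(1/p)]. Subadditivity
    then leaves the [p]-th root of a sum bounded by [4 * N f ^ p], whence the factor [4^(1/p)]. *)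
Lemma head_integral_le_small_exponent p f x e : (0 < p)%R -> (p <= 1)%R ->
  nonneg_nonincreasing f -> (0 < x)%R -> (0 <= e)%R ->
  (forall t : R, (0 < t)%R -> (t <= x)%R -> (U t <= e * V t `^ p^-1)%R) ->
  head_integral u f x <= (e * 4 `^ p^-1)%:E * weighted_norm p v f.
Proof.
move=> p0 p1 fn x0 e0 UV.
have fm := nonneg_nonincreasing_measurable fn.
have f0 : forall s, (0 < s)%R -> (0 <= f s)%R by case: fn.
have M1 : (1 < 2 :> R)%R by rewrite ltr1n.
have [t [tx Vt t0 tS tlim]] := geometric_levels vm VE M1 (V0 x0).
have Vt2 n : V (t n) = (2 * V (t n.+1))%R.
  by rewrite !Vt exprS; field; rewrite expf_neq0.
have tlex n : (t n <= x)%R.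
  by rewrite -tx; elim: n => // n IH; exact: le_trans (ltW (tS n)) IH.
apply: nonneg_integral_exhaust_left => //; first exact: nonneg_measurableM.
move=> a a0 ax; have [n tn] := tlim a (V0 a0).
apply: (@le_trans _ _ (\int[mu]_(s in `[t n, t 0%N[) (f s * u s)%:E)).
  rewrite tx; apply: nonneg_integral_sub; first exact: nonneg_measurableM.
    by move=> s/=; rewrite !in_itv/= => /andP[as_ ->]; rewrite (le_trans (ltW tn)).
  exact: sub_half_line_cb.
apply: (le_trans (ladder_head_integral_le t0 tS n fn um)).
set I := \int[mu]_(s in `]0%R, +oo[) (f s `^ p * v s)%:E.
have nI : (\sum_(k < n) f (t k.+1) `^ p * V (t k))%:E <= 4%:E * I.
  exact: ladder_weighted_norm_le (ltW p0) fn Vt2.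
under eq_bigr do rewrite UE -EFinM.
rewrite sumEFin.
apply: (@le_trans _ _ (e * (\sum_(k < n) f (t k.+1) `^ p * V (t k)) `^ p^-1)%:E); last first.
  rewrite [leRHS](_ : _ = e%:E * (4%:E * I) `^ p^-1).
    rewrite EFinM -poweR_EFin; apply: lee_wpmul2l; first by rewrite lee_fin.
    apply: gt0_ler_poweR => //; rewrite ?in_itv/= ?leey ?andbT ?invr_ge0 ?(ltW p0)//.
      rewrite lee_fin; apply: sumr_ge0 => k _.
      by rewrite mulr_ge0 ?powR_ge0// ltW// V0.
    by apply: le_trans nI; rewrite lee_fin; apply: sumr_ge0 => k _;
      rewrite mulr_ge0 ?powR_ge0// ltW// V0.
  rewrite EFinM -muleA -poweR_EFin -poweRM ?lee_fin//.
  apply: nonneg_integral_ge0 => //.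
  by apply: nonneg_measurableM => //; exact: nonneg_measurable_powR.
rewrite lee_fin.
have Vp k : (0 <= V (t k) `^ p^-1)%R by exact: powR_ge0.
have b0 k : (0 <= f (t k.+1) * V (t k) `^ p^-1)%R by rewrite mulr_ge0 ?f0.
apply: (@le_trans _ _ (e * \sum_(k < n) f (t k.+1) * V (t k) `^ p^-1)%R).
  rewrite mulr_sumr; apply: ler_sum => k _.
  by rewrite mulrCA; apply: ler_wpM2l; [exact: f0|exact: UV].
apply: ler_wpM2l => //.
(* The sum is rewritten as the root of its own [p]-th power, so that subadditivity applies under a
   monotone root. *)
have -> : (\sum_(k < n) f (t k.+1) * V (t k) `^ p^-1 =
    ((\sum_(k < n) f (t k.+1) * V (t k) `^ p^-1) `^ p) `^ p^-1)%R.
  by rewrite -powRrM mulfV ?gt_eqF// powRr1// sumr_ge0.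
apply: ge0_ler_powR; rewrite ?nnegrE ?invr_ge0 ?(ltW p0) ?powR_ge0//.
  by apply: sumr_ge0 => k _; rewrite mulr_ge0 ?powR_ge0// ltW// V0.
apply: le_trans (powR_sum_le n p0 p1 b0) _.
apply: ler_sum => k _; rewrite powRM ?f0// powR_invK ?gt_eqF// ltW// V0//.
Qed.

(** Real-valued counterpart of the integrand of [C6]. Where [V] vanishes and [q] is nonzero, the
    power with exponent [- q] is 0, whereas [C6] has the inverse [+oo] there. *)
Definition dual_density q x t : R :=
  ((U t / (U x + U t)) `^ q * V t `^ (- q) * v t)%R.

Lemma measurable_finite_primitive (g G : R -> R) (D : set R) :
  nonneg_measurable g -> (forall t, primitive g t = (G t)%:E) -> measurable D ->
  measurable_fun D G.
Proof.
by move=> gm GE mD; apply: nondecreasing_measurable => //; exact: (finite_primitive_nd gm GE).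
Qed.

Lemma nonneg_measurable_relative_primitive q x : (0 < x)%R ->
  nonneg_measurable (fun t => (U t / (U x + U t)) `^ q)%R.
Proof.
move=> x0; have Unn := finite_primitive_ge0 um UE.
have mU : measurable_fun (`]0%R, +oo[%classic : set R) U.
  exact: (measurable_finite_primitive um UE (measurable_itv _)).
split; last by move=> t _; exact: powR_ge0.
apply: (measurableT_comp (measurable_powR _)).
have -> : (fun t => U t / (U x + U t))%R = (fun t => U t * (U x + U t) `^ (- 1))%R.
  by apply/funext => t; rewrite powR_inv1// addr_ge0.
apply: measurable_funM => //; apply: (measurableT_comp (measurable_powR _)).
exact: measurable_funD.
Qed.

Lemma nonneg_measurable_dual_kernel q x : (0 < x)%R ->
  nonneg_measurable (fun t => (U t / (U x + U t)) `^ q * V t `^ (- q))%R.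
Proof.
move=> x0; apply: nonneg_measurableM; first exact: nonneg_measurable_relative_primitive.
split; last by move=> t _; exact: powR_ge0.
apply: (measurableT_comp (measurable_powR _)).
exact: (measurable_finite_primitive vm VE (measurable_itv _)).
Qed.

Lemma nonneg_measurable_dual_density q x : (0 < x)%R ->
  nonneg_measurable (dual_density q x).
Proof.
by move=> x0; apply: nonneg_measurableM => //; exact: nonneg_measurable_dual_kernel.
Qed.

Lemma powR_invl (y q : R) : (0 <= y)%R -> (y^-1 `^ q = y `^ (- q))%R.
Proof. by move=> y0; rewrite -powR_inv1// -powRrM mulN1r. Qed.

(** With [G = min (U a) (U x)], on [[a, b[] the quotient in the density is at least [G / (2 * U x)]
    and [V] is at most [2 * V a], while [v] has integral [V a]. The powers of [V a] combine through
    [1 - q = - q / p]. *)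
Lemma dual_step_le p q x a b : (0 < p)%R -> (0 < q)%R -> (p^-1 + q^-1 = 1)%R ->
  (0 < x)%R -> (0 < a)%R -> (a <= b)%R -> (V b = 2 * V a)%R ->
  ((Num.min (U a) (U x) * V a `^ (- p^-1)) `^ q)%:E <=
  ((4 * U x) `^ q)%:E * \int[mu]_(t in `[a, b[) (dual_density q x t)%:E.
Proof.
move=> p0 q0 pq x0 a0 ab Vb.
set G := Num.min (U a) (U x).
have Ux := U0 x0; have Ua := U0 a0; have Va := V0 a0.
have G0 : (0 < G)%R by rewrite lt_min Ua.
set k := ((G / (2 * U x)) `^ q * (2 * V a) `^ (- q))%R.
apply: (@le_trans _ _ (((4 * U x) `^ q)%:E * (k%:E * \int[mu]_(t in `[a, b[) (v t)%:E))).
  rewrite (finite_primitive_integral vm VE)// Vb -!EFinM lee_fin.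
  have -> : (2 * V a - V a = V a)%R by lra.
  rewrite /k -(@powR_invl (2 * V a) q) ?mulr_ge0 ?(ltW Va)// mulrA mulrA.
  rewrite -!powRM ?mulr_ge0 ?divr_ge0 ?invr_ge0 ?mulr_ge0 ?(ltW Ux) ?(ltW G0) ?(ltW Va)//.
  have -> : (4 * U x * (G / (2 * U x)) / (2 * V a) = G / V a)%R.
    by field; rewrite !gt_eqF.
  rewrite !powRM ?powR_ge0 ?invr_ge0 ?(ltW G0) ?(ltW Va)// -mulrA.
  apply: ler_wpM2l; first exact: powR_ge0.
  rewrite powR_invl ?(ltW Va)// -[X in (_ <= _ * X)%R]powRr1 ?(ltW Va)//.
  rewrite -powRD ?(lt0r_neq0 Va) ?implybT// -powRrM.
  have -> // : (- p^-1 * q = - q + 1)%R.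
  have -> : (p^-1 = 1 - q^-1)%R by lra.
  by field; rewrite gt_eqF.
apply: lee_wpmul2l; first by rewrite lee_fin powR_ge0.
apply: nonneg_integral_geZ => //.
- exact: nonneg_measurable_dual_kernel.
- by rewrite mulr_ge0 ?powR_ge0.
- exact: sub_half_line_cb.
move=> t; rewrite in_itv/= => /andP[at_ tb]; have t0 := lt_le_trans a0 at_.
have Ut := U0 t0.
have Uat : (U a <= U t)%R by exact: (finite_primitive_nd um UE).
have Vtb : (V t <= V b)%R by apply: (finite_primitive_nd vm VE); exact: ltW.
apply: ler_pM; rewrite ?powR_ge0//.
  apply: ge0_ler_powR; rewrite ?nnegrE ?(ltW q0) ?divr_ge0 ?addr_ge0
    ?mulr_ge0 ?(ltW Ux) ?(ltW Ut) ?(ltW G0)//.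
  rewrite ler_pdivrMr ?mulr_gt0// mulrAC ler_pdivlMr ?addr_gt0//.
  have Ga : (G <= U a)%R by rewrite ge_min lexx.
  have Gx : (G <= U x)%R by rewrite ge_min lexx orbT.
  nra.
rewrite -!powR_invl ?(ltW (V0 t0)) ?mulr_ge0 ?(ltW Va)//.
apply: ge0_ler_powR; rewrite ?nnegrE ?invr_ge0 ?mulr_ge0 ?(ltW q0) ?(ltW Va) ?(ltW (V0 t0))//.
by rewrite lef_pV2 ?posrE ?mulr_gt0 ?V0// -Vb.
Qed.

End finite_weight_estimates.

(** * Head integrals for [1 < p] *)

Section large_exponent.
Context {R : realType}.
Notation mu := (@lebesgue_measure R).
Variables (u v U V : R -> R).
Hypotheses (um : nonneg_measurable u) (vm : nonneg_measurable v).
Hypotheses (UE : forall t, primitive u t = (U t)%:E).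
Hypotheses (VE : forall t, primitive v t = (V t)%:E).
Hypothesis (U0 : forall t : R, (0 < t)%R -> (0 < U t)%R).
Hypothesis (Voo : forall c : R, exists y, (c < V y)%R).
Implicit Types (f : R -> R) (p q x j : R).

Lemma primitive_below_le x t :
  primitive (fun s => (s < x)%R%:R * u s)%R t <= (Num.min (U t) (U x))%:E.
Proof.
rewrite primitive_below UE lee_fin le_min.
by apply/andP; split; apply: (finite_primitive_nd um UE); rewrite ge_min lexx ?orbT.
Qed.

(** Hoelder's inequality separates the ladder sum into a factor controlled by the norm of [f],
    giving [4^(1/p)], and one controlled by the dual integral through [dual_step_le], giving
    [4 * U x]. *)
Lemma head_integral_le_large_exponent p q f x j :
  (0 < p)%R -> (0 < q)%R -> (p^-1 + q^-1 = 1)%R ->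
  (forall t : R, (0 < t)%R -> (0 < V t)%R) ->
  nonneg_nonincreasing f -> (0 < x)%R -> (0 <= j)%R ->
  \int[mu]_(t in `]0%R, +oo[) (dual_density v U V q x t)%:E <= j%:E ->
  head_integral u f x <= (4 * U x * j `^ q^-1 * 4 `^ p^-1)%:E * weighted_norm p v f.
Proof.
move=> p0 q0 pq V0 fn x0 j0 dj.
have fm := nonneg_nonincreasing_measurable fn.
have f0 : forall s, (0 < s)%R -> (0 <= f s)%R by case: fn.
have Ux := U0 x0.
(* The factor 2 leaves room for one level between [y] and [x], so that even the shifted ladder [t]
   starts beyond [x]. *)
have [y Vy] := Voo (2 * V x)%R.
have Vy0 : (0 < V y)%R by apply: lt_trans Vy; rewrite mulr_gt0 ?V0.
have M1 : (1 < 2 :> R)%R by rewrite ltr1n.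
have [r [ry Vr r0 rS rlim]] := geometric_levels vm VE M1 Vy0.
have Vr2 n : V (r n) = (2 * V (r n.+1))%R.
  by rewrite !Vr exprS; field; rewrite expf_neq0.
(* The shift makes [[t k, r k[] a block to the right of [t k], as [dual_step_le] needs, also for
   [k = 0]. *)
pose t n := r n.+1.
have t0 n : (0 < t n)%R by exact: r0.
have tS n : (t n.+1 < t n)%R by exact: rS.
have Vt2 n : V (t n) = (2 * V (t n.+1))%R by exact: Vr2.
have xt : (x < t 0%N)%R.
  apply: (finite_primitive_lt vm VE); have := Vr2 0%N; rewrite ry /t; lra.
have dm := nonneg_measurable_dual_density um vm UE VE q x0.
apply: nonneg_integral_exhaust_left => //; first exact: nonneg_measurableM.
move=> a a0 ax; have [n rn] := rlim a (V0 a a0).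
have tn : (t n < a)%R by exact: lt_trans (rS n) rn.
(* Cutting [u] off at [x] bounds its primitive by [min (U t) (U x)], the numerator in
   [dual_step_le]. *)
pose g := (fun s => (s < x)%R%:R * u s)%R.
have gm : nonneg_measurable g by apply: nonneg_measurableM => //; exact: nonneg_measurable_below.
apply: (@le_trans _ _ (\int[mu]_(s in `[t n, t 0%N[) (f s * g s)%:E)).
  under [leRHS]eq_integral do rewrite mulrCA.
  rewrite integral_below.
  have -> : `[t n, t 0%N[ `&` `]-oo, x[ = `[t n, x[%classic.
    apply/seteqP; split => s/=; rewrite !in_itv/=; first by move=> [/andP[-> _] ->].
    by move=> /andP[-> sx]; rewrite sx (lt_trans sx).
  apply: nonneg_integral_sub; first exact: nonneg_measurableM.
    by move=> s/=; rewrite !in_itv/= => /andP[as_ ->]; rewrite (le_trans (ltW tn)).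
  exact: sub_half_line_cb.
apply: (le_trans (ladder_head_integral_le t0 tS n fn gm)).
set I := \int[mu]_(s in `]0%R, +oo[) (f s `^ p * v s)%:E.
have I0 : 0 <= I.
  apply: nonneg_integral_ge0 => //.
  by apply: nonneg_measurableM => //; exact: nonneg_measurable_powR.
have nI : (\sum_(k < n) f (t k.+1) `^ p * V (t k))%:E <= 4%:E * I.
  exact: ladder_weighted_norm_le (ltW p0) fn Vt2.
pose G k := Num.min (U (t k)) (U x).
have G0 k : (0 <= G k)%R by rewrite le_min !ltW ?U0.
have nJ : (\sum_(k < n) (G k * V (t k) `^ (- p^-1)) `^ q <= (4 * U x) `^ q * j)%R.
  rewrite -lee_fin EFinM -sumEFin.
  apply: (@le_trans _ _ (((4 * U x) `^ q)%:E *
      \int[mu]_(s in `[r n, r 0%N[) (dual_density v U V q x s)%:E)).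
    rewrite (ladder_integral _ dm r0) => [|k]; last exact/ltW/rS.
    rewrite ge0_sume_distrr.
      by apply: lee_sum => k _; apply: (dual_step_le um vm UE VE U0 V0) => //; exact/ltW/rS.
    by move=> k _; apply: nonneg_integral_ge0 => //; exact: sub_half_line_cb (r0 _).
  apply: lee_wpmul2l; first by rewrite lee_fin powR_ge0.
  apply: le_trans dj; apply: nonneg_integral_sub => //; exact: sub_half_line_cb (r0 _).
have Va k : (0 < V (t k))%R by exact: V0.
have A0 k : (0 <= f (t k.+1) * V (t k) `^ p^-1)%R by rewrite mulr_ge0 ?f0 ?powR_ge0.
have B0 k : (0 <= G k * V (t k) `^ (- p^-1))%R by rewrite mulr_ge0 ?powR_ge0.
apply: (@le_trans _ _ (\sum_(k < n) (f (t k.+1) * V (t k) `^ p^-1) *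
    (G k * V (t k) `^ (- p^-1)))%:E).
  rewrite -sumEFin; apply: lee_sum => k _.
  have -> : (f (t k.+1) * V (t k) `^ p^-1 * (G k * V (t k) `^ (- p^-1)) = f (t k.+1) * G k)%R.
    by rewrite mulrACA powRN mulfV ?mulr1// gt_eqF// powR_gt0.
  rewrite EFinM; apply: lee_wpmul2l; first by rewrite lee_fin f0.
  exact: primitive_below_le.
apply: (@le_trans _ _ ((\sum_(k < n) f (t k.+1) `^ p * V (t k)) `^ p^-1 *
    (4 * U x * j `^ q^-1))%:E).
  rewrite lee_fin; apply: le_trans (finite_hoelder n p0 q0 pq A0 B0) _.
  apply: ler_pM; rewrite ?powR_ge0//.
    rewrite le_eqVlt; apply/orP; left; apply/eqP; congr powR.
    by apply: eq_bigr => k _; rewrite powRM ?f0 ?powR_ge0// powR_invK ?gt_eqF// ltW.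
  rewrite -[leRHS](_ : ((4 * U x) `^ q * j) `^ q^-1 = _)%R.
    apply: ge0_ler_powR; rewrite ?nnegrE ?invr_ge0 ?(ltW q0)//.
      by apply: sumr_ge0 => k _; exact: powR_ge0.
    by rewrite mulr_ge0 ?powR_ge0.
  by rewrite powRM ?powR_ge0// -powRrM mulfV ?gt_eqF// powRr1// mulr_ge0// ltW.
rewrite mulrC EFinM [in leRHS]EFinM -muleA; apply: lee_wpmul2l.
  by rewrite lee_fin mulr_ge0 ?powR_ge0// mulr_ge0// ltW.
rewrite -!poweR_EFin -poweRM ?lee_fin//.
have S0 : 0 <= (\sum_(k < n) f (t k.+1) `^ p * V (t k))%:E.
  by rewrite lee_fin; apply: sumr_ge0 => k _; rewrite mulr_ge0 ?powR_ge0// ltW.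
apply: gt0_ler_poweR => //; rewrite ?in_itv/= ?leey ?andbT ?invr_ge0 ?(ltW p0)//.
exact: le_trans nI.
Qed.

(** The density vanishes where [V] does, so the contradiction comes from small positive levels: if
    [V a = 0], the blocks to the right of [a] where [V] is comparable to [e] contribute about
    [e^(1 - q)], unbounded as [e] tends to 0 because [1 < q]. *)
Lemma primitive_pos_of_dual_finite q x j : (1 < q)%R -> (0 < x)%R ->
  \int[mu]_(t in `]0%R, +oo[) (dual_density v U V q x t)%:E <= j%:E ->
  forall t : R, (0 < t)%R -> (0 < V t)%R.
Proof.
move=> q1 x0 dj a a0; rewrite lt_neqAle (finite_primitive_ge0 vm VE) andbT.
apply/negP => /eqP Va.
have q0 : (0 < q)%R by exact: lt_trans q1.
have q1' : (0 < q - 1)%R by rewrite subr_gt0.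
have dm := nonneg_measurable_dual_density um vm UE VE q x0.
have Ua := U0 a0; have Ux := U0 x0.
have [y Vy0] := Voo 0%R.
pose k := ((U a / (U x + U a)) `^ q * 2^-1 `^ q)%R.
have k0 : (0 < k)%R by rewrite mulr_gt0 ?powR_gt0 ?divr_gt0 ?addr_gt0.
(* On the block where [V] runs from [e] to [2 * e] the integral is at least [k * e^(1 - q)]. *)
have bound (e : R) : (0 < e)%R -> (2 * e <= V y)%R -> (k <= j * e `^ (q - 1))%R.
  move=> e0 ey.
  have y0 : (0 < y)%R by exact: (finite_primitive_pos VE Vy0).
  have [|b _ Vb] := finite_primitive_onto vm VE (c := e) (ltW y0); first by lra.
  have [|c _ Vc] := finite_primitive_onto vm VE (c := (2 * e)%R) (ltW y0); first by lra.
  have ab : (a < b)%R by apply: (finite_primitive_lt vm VE); rewrite -Va Vb.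
  have bc : (b < c)%R by apply: (finite_primitive_lt vm VE); rewrite Vb Vc; lra.
  have b0 : (0 < b)%R by exact: lt_trans ab.
  have : ((U a / (U x + U a)) `^ q * (2 * e) `^ (- q))%:E * \int[mu]_(t in `[b, c[) (v t)%:E <= j%:E.
    apply: le_trans dj; apply: le_trans (nonneg_integral_sub dm _ _); last 2 first.
    - exact: (sub_half_line_cb (a := b) (b := BLeft c)).
    - exact: subset_refl.
    apply: nonneg_integral_geZ => //.
    + exact: (nonneg_measurable_dual_kernel um vm UE VE q x0).
    + by rewrite mulr_ge0 ?powR_ge0.
    + exact: sub_half_line_cb.
    move=> s; rewrite in_itv/= => /andP[bs sc]; have s0 := lt_le_trans b0 bs.
    have Us := U0 s0.
    have Uas : (U a <= U s)%R by apply: (finite_primitive_nd um UE); exact: le_trans (ltW ab) bs.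
    have Vsc : (V s <= V c)%R by apply: (finite_primitive_nd vm VE); exact: ltW.
    have Vs0 : (0 < V s)%R.
      by apply: (@lt_le_trans _ _ (V b)); [rewrite Vb|exact: (finite_primitive_nd vm VE)].
    apply: ler_pM; rewrite ?powR_ge0//.
      apply: ge0_ler_powR; rewrite ?nnegrE ?(ltW q0) ?divr_ge0 ?addr_ge0 ?(ltW Ux) ?(ltW Us) ?(ltW Ua)//.
      rewrite ler_pdivrMr ?addr_gt0// mulrAC ler_pdivlMr ?addr_gt0//.
      nra.
    rewrite -!powR_invl ?(ltW Vs0) ?mulr_ge0 ?(ltW e0)//.
    apply: ge0_ler_powR; rewrite ?nnegrE ?invr_ge0 ?mulr_ge0 ?(ltW q0) ?(ltW e0) ?(ltW Vs0)//.
    by rewrite lef_pV2 ?posrE ?mulr_gt0// -Vc.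
  rewrite (finite_primitive_integral vm VE) ?(ltW bc)// Vb Vc -EFinM lee_fin.
  have -> : (2 * e - e = e)%R by lra.
  have e1 : (0 < e `^ (q - 1))%R by exact: powR_gt0.
  rewrite -(ler_pM2r e1) => /(le_trans _); apply.
  have -> : ((2 * e) `^ (- q) = 2^-1 `^ q * e `^ (- q))%R.
    by rewrite powRM ?(ltW e0)// powR_invl.
  have ee : (e `^ (- q) * e * e `^ (q - 1) = 1)%R.
    rewrite -[X in (_ * X * _)%R]powRr1 ?(ltW e0)// -!powRD ?(lt0r_neq0 e0) ?implybT//.
    by rewrite (_ : - q + 1 + (q - 1) = 0)%R ?powRr0//; lra.
  rewrite [leRHS](_ : _ = k * (e `^ (- q) * e * e `^ (q - 1)))%R; first by rewrite ee mulr1.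
  by rewrite /k; ring.
have jpos : (0 < j)%R.
  have e0 : (0 < V y / 2)%R by rewrite divr_gt0.
  have := bound _ e0 (_ : 2 * (V y / 2) <= V y)%R.
  rewrite mulrC divfK// lexx => /(_ isT) h.
  by have := lt_le_trans k0 h; rewrite pmulr_lgt0// powR_gt0.
pose d := (k / (2 * j))%R.
have d0 : (0 < d)%R by rewrite divr_gt0// mulr_gt0.
(* The first entry makes the level [2 * e] attainable; the second gives [j * e^(q - 1) <= k / 2],
   contradicting [bound]. *)
pose e : R := Num.min (V y / 2)%R (d `^ (q - 1)^-1)%R.
have e0 : (0 < e)%R by rewrite lt_min divr_gt0//= powR_gt0.
have := bound e e0.
have -> : (2 * e <= V y)%R by rewrite mulrC -ler_pdivlMr// ge_min lexx.
move=> /(_ isT); apply/negP; rewrite -ltNge.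
apply: (@le_lt_trans _ _ (j * d)%R); last first.
  by rewrite /d (_ : j * (k / (2 * j)) = k / 2)%R; [lra|field; rewrite gt_eqF].
apply: ler_wpM2l; first exact: ltW.
rewrite -[leRHS](@powR_invK _ (q - 1)) ?gt_eqF ?(ltW d0)//.
by apply: ge0_ler_powR; rewrite ?nnegrE ?powR_ge0 ?(ltW q1') ?(ltW e0)// ge_min lexx orbT.
Qed.

End large_exponent.

(** * Best constants, degenerate cases, and both directions for [C5] *)

Section constants.
Context {R : realType}.
Notation mu := (@lebesgue_measure R).
Variables (u v w : R -> R).
Implicit Types (f U V : R -> R) (p q c x lam : R).

(** Here [A] may be [+oo]: a positive element of [S] then forces [K = +oo], and otherwise the
    supremum is at most 0. *)
Lemma mule_ereal_sup_le (A K : \bar R) (S : set (\bar R)) : 0 <= A -> 0 <= K ->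
  (forall y, S y -> A * y <= K) -> A * ereal_sup S <= K.
Proof.
move=> A0 K0 AS; have [S0|/ereal_sup_gt[y Sy y0]] := leP (ereal_sup S) 0.
  by apply: le_trans K0; exact: mule_ge0_le0.
case: A A0 AS => [a a0|_|//] AS.
  move: a0; rewrite lee_fin le_eqVlt => /predU1P[<-|a0]; first by rewrite mul0e.
  rewrite -lee_pdivlMl//; apply/ereal_supP => z Sz.
  by rewrite lee_pdivlMl//; exact: AS.
by have := AS _ Sy; rewrite gt0_mulye// leye_eq => /eqP ->; exact: leey.
Qed.

Lemma weighted_norm_ge0 p f : 0 <= weighted_norm p v f.
Proof. exact: poweR_ge0. Qed.

Lemma hardy_constants_le p c d : (c <= d)%R ->
  hardy_constants p u v w c -> hardy_constants p u v w d.
Proof.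
move=> cd [c0 cP]; split; first exact: le_trans cd.
move=> f fn; apply: le_trans (cP f fn) _.
by apply: lee_wpmul2r; [exact: weighted_norm_ge0|rewrite lee_fin].
Qed.

(** Both parts of the theorem reduce to two implications sharing one factor [lam]. Sufficiency is
    asked only for [0 < c], since [0 * +oo = 0] makes [c = 0] a delicate constant when the norm is
    infinite. *)
Lemma best_const_approx p (C : \bar R) lam : (0 < lam)%R -> 0 <= C ->
  (forall c, hardy_constants p u v w c -> C <= (lam * c)%:E) ->
  (forall c, (0 < c)%R -> C <= c%:E -> hardy_constants p u v w (lam * c)%R) ->
  ((exists c : R, hardy_constants p u v w c) <-> C < +oo) /\
  approx_with lam (best_const p u v w) C.
Proof.
move=> lam0 C0 nec suf; split; [split|split].
- by move=> [c /nec Cc]; apply: le_lt_trans Cc (ltry _).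
- case: C C0 {nec} suf => [r r0 suf _|//|//].
  exists (lam * (r + 1))%R; apply: suf; last by rewrite lee_fin lerDl.
  by rewrite ltr_wpDl.
- rewrite lee_pdivrMl//; case: C C0 {nec} suf => [r r0 suf|_ _|//]; last first.
    by rewrite gt0_muley ?lte_fin// leey.
  apply/lee_addgt0Pr => e e0; apply: ereal_inf_lbound.
  (* The shift by [e / lam] keeps the constant positive even if [r = 0] and costs exactly [e] in the
     infimum. *)
  exists (lam * (r + e / lam))%R; last by rewrite mulrDr mulrCA mulfV ?mulr1// gt_eqF.
  apply: suf; last by rewrite lee_fin lerDl divr_ge0// ltW.
  by rewrite ltr_wpDl// divr_gt0.
- rewrite muleC -lee_pdivrMr// muleC; apply/ereal_infP => _ [c hc <-].
  by rewrite lee_pdivrMl// -EFinM; exact: nec.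
Qed.

Hypotheses (wu : weight u) (wv : weight v) (ww : weight w).

Let um := weight_nonneg_measurable wu.
Let vm := weight_nonneg_measurable wv.

(** Monotonicity of [f] bounds [f s ^ p * V s] by the integral, and this product is [+oo] unless
    [f s = 0]. *)
Lemma primitive_infinite_norm_finite p f : (0 < p)%R ->
  (forall t : R, (0 < t)%R -> primitive v t = +oo) -> nonneg_nonincreasing f ->
  \int[mu]_(x in `]0%R, +oo[) (f x `^ p * v x)%:E < +oo ->
  forall s : R, (0 < s)%R -> f s = 0%R.
Proof.
move=> p0 Voo fn fp s s0; have fm := nonneg_nonincreasing_measurable fn.
have fs : (0 <= f s)%R by case: fn => _ + _; apply.
have [//|fs0] := eqVneq (f s) 0%R.
have fsp : (0 < f s `^ p)%R by rewrite powR_gt0// lt_def fs0.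
move: fp; rewrite ltNge leye_eq => /negP[]; apply/eqP/eqP.
rewrite -leye_eq; apply: (@le_trans _ _ ((f s `^ p)%:E * primitive v s)).
  by rewrite Voo// gt0_muley ?lte_fin.
have fpm := nonneg_measurable_powR p fm.
apply: (@le_trans _ _ (\int[mu]_(x in `]0%R, s[) (f x `^ p * v x)%:E)).
  apply: nonneg_integral_geZ => //; [exact: ltW|exact: sub_half_line_ob|].
  move=> x; rewrite in_itv/= => /andP[x0 xs]; case: fn => _ f0 fni.
  by apply: ge0_ler_powR; rewrite ?nnegrE ?f0 ?fni// ltW.
apply: nonneg_integral_sub => //; first exact: nonneg_measurableM.
exact: sub_half_line_ob.
Qed.

Variable U : R -> R.
Hypotheses (UE : forall t, primitive u t = (U t)%:E).
Hypothesis (U0 : forall t : R, (0 < t)%R -> (0 < U t)%R).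

(** Leaves only real-valued [V] to treat: an infinite norm makes the inequality trivial because
    [0 < c], and for infinite [V] a finite norm forces [f = 0]. The factor 3 is that of
    [hardy_lhs_le]. *)
Lemma hardy_constants_of_head_bound p lam c : (0 < p)%R -> (0 < lam)%R -> (0 < c)%R ->
  (forall V f x, (forall t, primitive v t = (V t)%:E) ->
    nonneg_nonincreasing f -> (0 < x)%R ->
    weight_sup u w x * (primitive u x)^-1 * head_integral u f x <=
    (lam * c)%:E * weighted_norm p v f) ->
  hardy_constants p u v w (3 * lam * c)%R.
Proof.
move=> p0 lam0 c0 head; have lc0 : (0 < 3 * lam * c)%R by rewrite !mulr_gt0.
split; first exact: ltW.
move=> f fn; have fm := nonneg_nonincreasing_measurable fn.
have [Nfin|] := ltP (weighted_norm p v f) +oo; last first.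
  by rewrite leye_eq => /eqP ->; rewrite gt0_muley ?lte_fin// leey.
rewrite -mulrA EFinM -muleA; apply: (hardy_lhs_le wu ww UE U0 fm) => x x0.
have [Vfin|Voo] := primitive_finite_or_infinite wv.
  apply: (head (fun t => fine (primitive v t))) => // t.
  by rewrite fineK// ge0_fin_numE ?Vfin// primitive_ge0.
have f0 : forall s : R, (0 < s)%R -> f s = 0%R.
  apply: (primitive_infinite_norm_finite p0 Voo fn).
  by apply: lty_poweRy Nfin; rewrite invr_eq0 gt_eqF.
rewrite /head_integral integral0_eq ?mule0.
  by rewrite mule_ge0 ?weighted_norm_ge0// lee_fin mulr_ge0// ltW.
by move=> t; rewrite /= in_itv/= => /andP[t0 _]; rewrite f0// mul0r.
Qed.

Let ratio p t : \bar R := primitive u t / (primitive v t `^ p^-1).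

Lemma ratio_ge0 p t : (0 < t)%R -> 0 <= ratio p t.
Proof.
by move=> t0; rewrite /ratio mule_ge0 ?primitive_ge0// inve_ge0 poweR_ge0.
Qed.

Let weight_sup_div_ge0 x : (0 < x)%R -> 0 <= weight_sup u w x * (primitive u x)^-1.
Proof.
move=> x0; rewrite mule_ge0 ?(weight_sup_ge0 ww UE U0)// inve_ge0.
exact: primitive_ge0.
Qed.

Lemma ratio_sup_ge0 p x : (0 < x)%R ->
  0 <= ereal_sup [set ratio p t | t in `]0%R, x[].
Proof.
move=> x0; apply: le_ereal_sup_tmp; exists (ratio p (x / 2)%R).
  exists (x / 2)%R => //=; rewrite in_itv/= divr_gt0//=; lra.
by apply: ratio_ge0; rewrite divr_gt0.
Qed.

Lemma C5_ge0 p : 0 <= C5 p u v w.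
Proof.
apply: le_ereal_sup_tmp; eexists; first by exists 1%R => //=; rewrite in_itv/= ltr01.
apply: mule_ge0; first exact: weight_sup_div_ge0.
exact: ratio_sup_ge0.
Qed.

Lemma C6_ge0 q : 0 <= C6 q u v w.
Proof.
apply: le_ereal_sup_tmp; eexists; first by exists 1%R => //=; rewrite in_itv/= ltr01.
by apply: mule_ge0; [exact: (weight_sup_ge0 ww UE U0 ltr01)|exact: poweR_ge0].
Qed.

(** Unless [A] is 0, a finite [C5] bounds [U] by a multiple of [V^(1/p)] below [x], which is the
    input of the ladder estimate. *)
Lemma hardy_constants_of_C5 p c : (0 < p)%R -> (p <= 1)%R -> (0 < c)%R ->
  C5 p u v w <= c%:E -> hardy_constants p u v w (3 * (2 * 4 `^ p^-1) * c)%R.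
Proof.
move=> p0 p1 c0 C5c.
have l0 : (0 < 2 * 4 `^ p^-1 :> R)%R by rewrite mulr_gt0// powR_gt0.
apply: hardy_constants_of_head_bound => // V f x VE fn x0.
have rhs0 : 0 <= (2 * 4 `^ p^-1 * c)%:E * weighted_norm p v f.
  by rewrite mule_ge0 ?weighted_norm_ge0// lee_fin mulr_ge0// ltW.
set A := weight_sup u w x * (primitive u x)^-1.
have [A0|An0] := eqVneq A 0; first by rewrite A0 mul0e.
have Apos : 0 < A by rewrite lt_def An0 weight_sup_div_ge0.
pose D := ereal_sup [set ratio p t | t in `]0%R, x[].
have D0 : 0 <= D by exact: ratio_sup_ge0.
have AD : A * D <= c%:E.
  by apply: le_trans C5c; apply: ereal_sup_ubound; exists x => //=; rewrite in_itv/= x0.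
have Dub t : (0 < t)%R -> (t < x)%R -> ratio p t <= D.
  by move=> t0 tx; apply: ereal_sup_ubound; exists t => //=; rewrite in_itv/= t0.
have [d dE] : exists d, D = d%:E.
  case: D D0 AD {Dub} => [d|_|//]; first by exists d.
  by rewrite gt0_muley.
have d0 : (0 <= d)%R by rewrite -lee_fin -dE.
(* A zero of [V] would give the ratio [U t / 0 = +oo], exceeding the finite [D]. *)
have Vlt t : (0 < t)%R -> (t < x)%R -> (0 < V t)%R.
  move=> t0 tx; rewrite lt_neqAle (finite_primitive_ge0 vm VE) andbT eq_sym.
  apply/negP => /eqP Vt; have := Dub t t0 tx.
  rewrite /ratio VE Vt poweR_EFin powR0 ?invr_eq0 ?gt_eqF// inver eqxx.
  by rewrite gt0_muley ?UE ?lte_fin ?U0// dE.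
have V0 t : (0 < t)%R -> (0 < V t)%R.
  move=> t0; have [tx|xt] := ltP t x; first exact: Vlt.
  apply: (@lt_le_trans _ _ (V (x / 2)%R)); first by apply: Vlt; lra.
  by apply: (finite_primitive_nd vm VE); lra.
have UVlt t : (0 < t)%R -> (t < x)%R -> (U t <= d * V t `^ p^-1)%R.
  move=> t0 tx; have := Dub t t0 tx; have Vp : (0 < V t `^ p^-1)%R by exact/powR_gt0/V0.
  by rewrite /ratio UE VE poweR_EFin inve_EFin_pos// dE -EFinM lee_fin ler_pdivrMr.
(* The supremum runs over [t < x] only; passing to a halving point reaches [t = x] and costs the
   factor 2. *)
have UV t : (0 < t)%R -> (t <= x)%R -> (U t <= 2 * d * V t `^ p^-1)%R.
  move=> t0 tx; have [s [s0 st Ust]] := halving_point wu UE U0 t0.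
  apply: (le_trans Ust); rewrite -mulrA ler_wpM2l//.
  apply: (le_trans (UVlt s s0 (lt_le_trans st tx))); apply: ler_wpM2l => //.
  apply: ge0_ler_powR; rewrite ?nnegrE ?invr_ge0 ?(ltW p0) ?(ltW (V0 _ _))//.
  by apply: (finite_primitive_nd vm VE); exact: ltW.
have h := head_integral_le_small_exponent um vm UE VE V0 p0 p1 fn x0
  (mulr_ge0 (ler0n _ 2) d0) UV.
apply: (@le_trans _ _ (A * ((2 * d * 4 `^ p^-1)%:E * weighted_norm p v f))).
  by apply: lee_wpmul2l => //; exact: ltW.
have -> : (2 * d * 4 `^ p^-1 = d * (2 * 4 `^ p^-1))%R by ring.
move: (2 * 4 `^ p^-1)%R l0 => L l0.
rewrite [(L * c)%R]mulrC !EFinM -(muleA d%:E) -(muleA c%:E) (muleA A) -dE.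
apply: lee_wpmul2r => //.
by rewrite mule_ge0 ?weighted_norm_ge0// lee_fin ltW.
Qed.

(** The inequality is tested on the indicator of []0, t[]. The case [t = x] later shows that [A] is
    finite. *)
Lemma weight_sup_primitive_le p c t x : (0 < p)%R ->
  hardy_constants p u v w c -> (0 < x)%R -> (t <= x)%R ->
  weight_sup u w x * (primitive u x)^-1 * primitive u t <=
  c%:E * primitive v t `^ p^-1.
Proof.
move=> p0 [c0 cP] x0 tx; pose f := (fun s => (s < t)%R%:R : R).
have fn : nonneg_nonincreasing f.
  split; first exact: (nonneg_measurable_below t).1.
    by move=> s _; exact: ler0n.
  move=> a b _ ab; rewrite ler_nat; case: (ltP b t) => // bt.
  by rewrite (le_lt_trans ab bt).
have := weight_sup_head_integral_le wu ww UE U0 fn (cP f fn) x0.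
rewrite /head_integral.
have -> : \int[mu]_(s in `]0%R, x[) (f s * u s)%:E = primitive u t.
  by have := primitive_below t x u; rewrite min_l// /primitive => ->.
rewrite /weighted_norm -(half_line_integral_below t v).
have -> // : \int[mu]_(s in `]0%R, +oo[) (f s `^ p * v s)%:E =
  \int[mu]_(s in `]0%R, +oo[) ((s < t)%R%:R * v s)%:E.
apply: eq_integral => s _; rewrite /f.
by case: (s < t)%R; rewrite ?powR1 ?powR0 ?gt_eqF.
Qed.

Lemma C5_le_hardy_constant p c : (0 < p)%R ->
  hardy_constants p u v w c -> C5 p u v w <= c%:E.
Proof.
move=> p0 cP; have c0 : (0 <= c)%R by case: cP.
apply/ereal_supP => _ [x + <-]; rewrite /= in_itv/= andbT => x0.
set A := _ * (primitive u x)^-1; have A0 : 0 <= A by exact: weight_sup_div_ge0.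
apply: mule_ereal_sup_le => // _ [t + <-]; rewrite /= in_itv/= => /andP[t0 tx].
have : A * primitive u t <= c%:E * primitive v t `^ p^-1.
  exact: weight_sup_primitive_le p0 cP x0 (ltW tx).
(* If [V t = +oo] the ratio is 0. If [V t = 0] the ratio is [+oo], but the tested inequality then
   forces [A = 0]. *)
rewrite UE; case: (primitive v t) (primitive_ge0 t vm) => [r|_ _|//]; last first.
  by rewrite poweRyr ?invr_eq0 ?gt_eqF// invey !mule0 lee_fin.
rewrite lee_fin poweR_EFin => r0.
have [->|rn0] := eqVneq r 0%R.
  rewrite powR0 ?invr_eq0 ?gt_eqF// mule0 => AU.
  suff -> : A = 0 by rewrite mul0e lee_fin.
  apply/eqP; rewrite eq_le A0 andbT leNgt; apply/negP => Apos.
  by move: AU; rewrite leNgt mule_gt0// lte_fin U0.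
have rp : (0 < r `^ p^-1)%R by rewrite powR_gt0// lt_def rn0.
by rewrite inve_EFin_pos// muleA lee_pdivrMr.
Qed.

End constants.

(** * Step functions with decreasing jump points *)

Section step_functions.
Context {R : realType}.
Notation mu := (@lebesgue_measure R).
Variables (r a : nat -> R) (N : nat).
Hypotheses (rS : forall n, (r n.+1 < r n)%R) (a0 : forall n, (0 <= a n)%R).

Definition step_sum (s : R) : R := (\sum_(n < N) a n * (s < r n)%R%:R)%R.

Lemma step_sum_nonincreasing : nonneg_nonincreasing step_sum.
Proof.
split.
- apply: measurable_sum => n; apply: measurable_funM; first exact: measurable_cst.
  exact: (nonneg_measurable_below (r n)).1.
- by move=> s _; apply: sumr_ge0 => n _; rewrite mulr_ge0.
- move=> x y _ xy; apply: ler_sum => n _; apply: ler_wpM2l => //.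
  by rewrite ler_nat; case: (ltP y (r n)) => // yr; rewrite (le_lt_trans xy yr).
Qed.

Lemma integral_step_sum (i : interval R) g : nonneg_measurable g ->
  [set` i] `<=` `]0%R, +oo[%classic ->
  \int[mu]_(s in [set` i]) (step_sum s * g s)%:E =
  \sum_(n < N) (a n)%:E * \int[mu]_(s in [set` i]) ((s < r n)%R%:R * g s)%:E.
Proof.
move=> gm iD.
have hm (n : 'I_N) : nonneg_measurable (fun s => (s < r n)%R%:R * g s)%R.
  by apply: nonneg_measurableM => //; exact: nonneg_measurable_below.
have ahm (n : 'I_N) : nonneg_measurable (fun s => a n * ((s < r n)%R%:R * g s))%R.
  by apply: nonneg_measurableM => //; exact: nonneg_measurable_cst.
under eq_integral do rewrite /step_sum mulr_suml -sumEFin.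
under eq_integral do under eq_bigr do rewrite -mulrA.
rewrite ge0_integral_sum//.
- by apply: eq_bigr => n _; rewrite nonneg_integralZl.
- by move=> n; have [] := nonneg_measurable_on iD (ahm n).
- by move=> n s; have [_] := nonneg_measurable_on iD (ahm n); exact.
Qed.

(** The pointwise bound [powR_step_sum_le] is integrated against [v]; the result has the shape that
    [geometric_hardy] estimates. *)
Lemma step_sum_norm_le p v : (0 < p)%R -> nonneg_measurable v ->
  \int[mu]_(s in `]0%R, +oo[) (step_sum s `^ p * v s)%:E <=
  \sum_(n < N) ((\sum_(k < n.+1) a k)%R `^ p)%:E * primitive v (r n).
Proof.
move=> p0 vm.
pose b n := ((\sum_(k < n.+1) a k) `^ p)%R.
have sm := nonneg_nonincreasing_measurable step_sum_nonincreasing.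
have bm (n : 'I_N) : nonneg_measurable (fun s => b n * ((s < r n)%R%:R * v s))%R.
  apply: nonneg_measurableM; first exact/nonneg_measurable_cst/powR_ge0.
  by apply: nonneg_measurableM => //; exact: nonneg_measurable_below.
have iD : [set` `]0%R, +oo[] `<=` (`]0%R, +oo[%classic : set R) by [].
apply: (@le_trans _ _ (\int[mu]_(s in `]0%R, +oo[)
    (\sum_(n < N) b n * ((s < r n)%R%:R * v s))%:E)).
  apply: nonneg_integral_le => //.
  - by apply: nonneg_measurableM => //; exact: nonneg_measurable_powR.
  - split; first by apply: measurable_sum => n; exact: (bm n).1.
    by move=> s s0; apply: sumr_ge0 => n _; exact: (bm n).2.
  move=> s; rewrite in_itv/= andbT => s0.
  under eq_bigr do rewrite mulrA; rewrite -mulr_suml.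
  apply: ler_wpM2r; first exact: (proj2 vm).
  by apply: powR_step_sum_le => // n; exact/ltW.
under eq_integral do rewrite -sumEFin.
rewrite ge0_integral_sum//.
- apply: lee_sum => n _; rewrite nonneg_integralZl ?powR_ge0//; last first.
    by apply: nonneg_measurableM => //; exact: nonneg_measurable_below.
  by rewrite half_line_integral_below.
- by move=> n; have [] := nonneg_measurable_on iD (bm n).
- by move=> n s; have [_] := nonneg_measurable_on iD (bm n); exact.
Qed.

End step_functions.

(** * Both directions for [C6] *)

Section dual_constant.
Context {R : realType}.
Notation mu := (@lebesgue_measure R).
Variables (u v w U : R -> R).
Implicit Types (f V : R -> R) (p q c x alpha : R).
Hypotheses (wu : weight u) (wv : weight v) (ww : weight w).
Hypotheses (UE : forall t, primitive u t = (U t)%:E).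
Hypothesis (U0 : forall t : R, (0 < t)%R -> (0 < U t)%R).

Let um := weight_nonneg_measurable wu.
Let vm := weight_nonneg_measurable wv.

Definition dual_integral q x : \bar R :=
  \int[mu]_(t in `]0%R, +oo[)
    (calU (primitive u) t x `^ q * ((v t)%:E / (primitive v t `^ q))).

(** Makes the value [+oo] of [1 / 0] explicit, so that measurability can be checked by cases. *)
Lemma dual_integrandE V q x t : (forall t, primitive v t = (V t)%:E) ->
  (0 < q)%R -> (0 < x)%R -> (0 < t)%R ->
  calU (primitive u) t x `^ q * ((v t)%:E / (primitive v t `^ q)) =
  ((U t / (U x + U t)) `^ q)%:E *
  ((v t)%:E * (if (V t <= 0)%R then +oo else (V t `^ (- q))%:E)).
Proof.
move=> VE q0 x0 t0; rewrite (calUE UE U0)// poweR_EFin VE poweR_EFin.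
have [Vt|Vt] := leP (V t) 0%R.
  have -> : V t = 0%R by apply/le_anti; rewrite Vt (finite_primitive_ge0 vm VE).
  by rewrite powR0 ?gt_eqF// inver eqxx.
by rewrite inve_EFin_pos ?powR_gt0// powRN.
Qed.

Lemma dual_density_integral_le V q x : (forall t, primitive v t = (V t)%:E) ->
  (0 < q)%R -> (0 < x)%R ->
  \int[mu]_(t in `]0%R, +oo[) (dual_density v U V q x t)%:E <= dual_integral q x.
Proof.
move=> VE q0 x0.
have mD : measurable (`]0%R, +oo[%classic : set R) by exact: measurable_itv.
have mU : measurable_fun (`]0%R, +oo[%classic : set R) U.
  exact: (measurable_finite_primitive um UE).
have mV : measurable_fun (`]0%R, +oo[%classic : set R) V.
  exact: (measurable_finite_primitive vm VE).
have dm := nonneg_measurable_dual_density um vm UE VE q x0.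
rewrite /dual_integral.
have -> : \int[mu]_(t in `]0%R, +oo[)
    (calU (primitive u) t x `^ q * ((v t)%:E / (primitive v t `^ q))) =
  \int[mu]_(t in `]0%R, +oo[) (((U t / (U x + U t)) `^ q)%:E *
  ((v t)%:E * (if (V t <= 0)%R then +oo else (V t `^ (- q))%:E))).
  apply: eq_integral => t; rewrite inE/= in_itv/= andbT => t0.
  exact: dual_integrandE.
have iD : [set` `]0%R, +oo[] `<=` (`]0%R, +oo[%classic : set R) by [].
have [mdd dd0] := nonneg_measurable_on iD dm.
apply: ge0_le_integral => //.
  apply: emeasurable_funM.
    exact: (nonneg_measurable_on iD (nonneg_measurable_relative_primitive um UE q x0)).1.
  apply: emeasurable_funM; first by apply/measurable_EFinP; exact: (proj1 vm).
  apply: measurable_fun_if => //.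
    by apply: measurable_fun_ler => //; exact: measurable_cst.
  apply/measurable_EFinP; apply: measurable_funS mD _ _; first exact: subIsetl.
  exact: (measurableT_comp (measurable_powR _) mV).
move=> t; rewrite /= in_itv/= andbT => t0.
have vt : (0 <= v t)%R by exact: (proj2 vm).
rewrite /dual_density -mulrA EFinM; apply: lee_wpmul2l.
  by rewrite lee_fin powR_ge0.
rewrite mulrC EFinM; apply: lee_wpmul2l; first by rewrite lee_fin.
by case: ifP; rewrite ?leey.
Qed.

Lemma dual_integralE V q x : (forall t, primitive v t = (V t)%:E) ->
  (0 < q)%R -> (0 < x)%R -> (forall t : R, (0 < t)%R -> (0 < V t)%R) ->
  dual_integral q x = \int[mu]_(t in `]0%R, +oo[) (dual_density v U V q x t)%:E.
Proof.
move=> VE q0 x0 V0; apply: eq_integral => t; rewrite inE/= in_itv/= andbT => t0.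
rewrite (dual_integrandE VE)// leNgt V0//= -!EFinM /dual_density; congr EFin; ring.
Qed.

Lemma dual_integral_ge0 q x : 0 <= dual_integral q x.
Proof.
apply: integral_ge0 => t; rewrite /= in_itv/= andbT => t0.
apply: mule_ge0; first exact: poweR_ge0.
by rewrite mule_ge0 ?inve_ge0 ?poweR_ge0// lee_fin (proj2 vm).
Qed.

(** When [A] is positive, a finite [C6] makes the dual integral finite; that forces [V] to be
    positive and feeds the Hoelder estimate. The limit of [V] at infinity provides ladders starting
    beyond [x]. *)
Lemma hardy_constants_of_C6 p q c :
  (1 < p)%R -> (p^-1 + q^-1 = 1)%R -> (0 < c)%R ->
  primitive v t @[t --> +oo%R] --> +oo ->
  C6 q u v w <= c%:E -> hardy_constants p u v w (3 * (4 * 4 `^ p^-1) * c)%R.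
Proof.
move=> p1 pq c0 vlim C6c.
have p0 : (0 < p)%R by exact: lt_trans p1.
have q1 : (1 < q)%R.
  have h : (p^-1 < 1)%R by rewrite invf_lt1.
  have h' : (0 < p^-1)%R by rewrite invr_gt0.
  have q0 : (0 < q)%R by rewrite -invr_gt0; lra.
  rewrite -[q]invrK invf_gt1 ?invr_gt0//; lra.
have q0 : (0 < q)%R by exact: lt_trans q1.
have l0 : (0 < 4 * 4 `^ p^-1 :> R)%R by rewrite mulr_gt0// powR_gt0.
apply: (hardy_constants_of_head_bound wu wv ww UE U0 p0 l0 c0) => V f x VE fn x0.
have Ux := U0 x0.
have Voo b : exists y, (b < V y)%R.
  have /filter_ex[y] : \forall t \near +oo%R, b%:E < primitive v t.
    by apply: (vlim [set z | b%:E < z]); exists b; rewrite num_real.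
  by rewrite VE lte_fin => by_; exists y.
have rhs0 : 0 <= (4 * 4 `^ p^-1 * c)%:E * weighted_norm p v f.
  by rewrite mule_ge0 ?weighted_norm_ge0// lee_fin mulr_ge0// ltW.
set A := weight_sup u w x.
have A0 : 0 <= A by exact: (weight_sup_ge0 ww UE U0).
have [Az|An0] := eqVneq A 0; first by rewrite Az !mul0e.
have Apos : 0 < A by rewrite lt_def An0.
have AJ : A * (dual_integral q x) `^ q^-1 <= c%:E.
  by apply: le_trans C6c; apply: ereal_sup_ubound; exists x => //=; rewrite in_itv/= x0.
have [j [j0 jE]] : exists j, (0 <= j)%R /\ dual_integral q x = j%:E.
  case: (dual_integral q x) (dual_integral_ge0 q x) AJ => [j j0 _|_|//]; first by exists j.
  by rewrite poweRyr ?invr_eq0 ?gt_eqF// gt0_muley.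
have dj : \int[mu]_(t in `]0%R, +oo[) (dual_density v U V q x t)%:E <= j%:E.
  by rewrite -jE; exact: dual_density_integral_le.
have V0 := primitive_pos_of_dual_finite um vm UE VE U0 Voo q1 x0 dj.
have h := head_integral_le_large_exponent um vm UE VE U0 Voo p0 q0 pq V0 fn x0 j0 dj.
move: AJ; rewrite jE poweR_EFin => AJ.
rewrite UE inve_EFin_pos//.
apply: (@le_trans _ _ (A * ((U x)^-1)%:E *
    ((4 * U x * j `^ q^-1 * 4 `^ p^-1)%:E * weighted_norm p v f))).
  by apply: lee_wpmul2l => //; rewrite mule_ge0// lee_fin invr_ge0 ltW.
rewrite -muleA (muleA ((U x)^-1)%:E) -EFinM.
have -> : ((U x)^-1 * (4 * U x * j `^ q^-1 * 4 `^ p^-1) =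
    j `^ q^-1 * (4 * 4 `^ p^-1))%R by field; rewrite gt_eqF.
move: (4 * 4 `^ p^-1)%R l0 => L l0.
rewrite [(L * c)%R]mulrC !EFinM -(muleA (j `^ q^-1)%:E) -(muleA c%:E) (muleA A).
apply: lee_wpmul2r => //.
by rewrite mule_ge0 ?weighted_norm_ge0// lee_fin ltW.
Qed.

(** Converse of [dual_step_le]: on [[a, b[] the quotient is at most [min (U b) (U x) / U x], [V] is
    at least [V b / M], and [v] has integral at most [V b]. *)
Lemma dual_step_ge V (M : R) q x a b : (forall t, primitive v t = (V t)%:E) ->
  (0 < M)%R -> (0 < q)%R -> (0 < x)%R -> (0 < a)%R -> (a <= b)%R ->
  (0 < V a)%R -> (V b = M * V a)%R ->
  \int[mu]_(t in `[a, b[) (dual_density v U V q x t)%:E <=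
  ((M / U x) `^ q * ((Num.min (U b) (U x) / V b) `^ q * V b))%:E.
Proof.
move=> VE M0 q0 x0 a0 ab Va Vb.
set G := Num.min (U b) (U x).
have Ux := U0 x0; have Ub := U0 (lt_le_trans a0 ab).
have G0 : (0 < G)%R by rewrite lt_min Ub.
have Vb0 : (0 < V b)%R by rewrite Vb mulr_gt0.
apply: (@le_trans _ _ (((G / U x) `^ q * V a `^ (- q))%:E * \int[mu]_(t in `[a, b[) (v t)%:E)).
  apply: nonneg_integral_leZ => //.
  - exact: (nonneg_measurable_dual_kernel um vm UE VE q x0).
  - by rewrite mulr_ge0 ?powR_ge0.
  - exact: sub_half_line_cb.
  move=> t; rewrite in_itv/= => /andP[at_ tb]; have t0 := lt_le_trans a0 at_.
  have Ut := U0 t0.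
  have Utb : (U t <= U b)%R by apply: (finite_primitive_nd um UE); exact: ltW.
  have Vat : (V a <= V t)%R by apply: (finite_primitive_nd vm VE).
  apply: ler_pM; rewrite ?powR_ge0//.
    apply: ge0_ler_powR; rewrite ?nnegrE ?(ltW q0) ?divr_ge0 ?addr_ge0 ?(ltW Ux) ?(ltW Ut) ?(ltW G0)//.
    rewrite ler_pdivrMr ?addr_gt0// mulrAC ler_pdivlMr//.
    by rewrite /G; case: (leP (U b) (U x)) => _; nra.
  rewrite -!powR_invl ?(ltW Va) ?(le_trans (ltW Va) Vat)//.
  apply: ge0_ler_powR; rewrite ?nnegrE ?invr_ge0 ?(ltW q0) ?(ltW Va) ?(le_trans (ltW Va) Vat)//.
  by rewrite lef_pV2 ?posrE ?(lt_le_trans Va Vat).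
rewrite (finite_primitive_integral vm VE)// -EFinM lee_fin.
apply: (@le_trans _ _ ((G / U x) `^ q * V a `^ (- q) * V b)%R).
  by apply: ler_wpM2l; rewrite ?mulr_ge0 ?powR_ge0// gerBl ltW.
rewrite mulrA; apply: ler_wpM2r; first exact: ltW.
rewrite -powR_invl ?(ltW Va)//.
rewrite -!powRM ?divr_ge0 ?invr_ge0 ?(ltW Ux) ?(ltW Va) ?(ltW G0) ?(ltW M0) ?(ltW Vb0)//.
have -> // : (G / U x / V a = M / U x * (G / V b))%R.
by rewrite Vb; field; rewrite !gt_eqF.
Qed.

(* The test function [\sum_n h_n ^ (q - 1) * 1_(0, r_n)] along the levels
   [V (r_n) = V b / M ^ n], where [h_n = min (U r_n) (U x) / V (r_n)]. *)
Lemma dual_ladder_le V p q c alpha x b N (r : nat -> R) :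
  let M := (2 * 2 `^ p)%R in
  (forall t, primitive v t = (V t)%:E) ->
  (forall t : R, (0 < t)%R -> (0 < V t)%R) ->
  (0 < p)%R -> (0 < q)%R -> (p^-1 + q^-1 = 1)%R ->
  hardy_constants p u v w c -> (0 < x)%R -> (0 < alpha)%R ->
  weight_sup u w x = alpha%:E ->
  (forall n, V (r n) = M * V (r n.+1))%R ->
  (forall n, (0 < r n)%R) -> (forall n, (r n.+1 < r n)%R) -> r 0%N = b ->
  \int[mu]_(t in `[r N, b[) (dual_density v U V q x t)%:E <=
  ((M * M `^ p^-1 * c / alpha) `^ q)%:E.
Proof.
move=> M VE V0 p0 q0 pq cP x0 al0 wE rV r0 rS <-.
have c0 : (0 <= c)%R by case: cP.
have Ux := U0 x0.
have M0 : (0 < M)%R by rewrite mulr_gt0// powR_gt0.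
have dm := nonneg_measurable_dual_density um vm UE VE q x0.
pose G n := Num.min (U (r n)) (U x).
have G0 n : (0 < G n)%R by rewrite lt_min !U0.
have Vr0 n : (0 < V (r n))%R by exact: V0.
pose h n := (G n / V (r n))%R.
have h0 n : (0 < h n)%R by rewrite divr_gt0.
(* The exponent gives both [a n * min (U r_n) (U x) = h n ^ q * V r_n] and [a n ^ p = h n ^ q], so
   the head integral equals [S] and the norm is governed by [S] as well. *)
pose a n := (h n `^ (q - 1))%R.
have a0 n : (0 <= a n)%R by exact: powR_ge0.
pose S := (\sum_(n < N) h n `^ q * V (r n))%R.
have S0 : (0 <= S)%R.
  by apply: sumr_ge0 => n _; rewrite mulr_ge0 ?powR_ge0// ltW.
apply: (@le_trans _ _ ((M / U x) `^ q * S)%:E).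
  rewrite (ladder_integral N dm r0) => [|n]; last exact/ltW/rS.
  rewrite /S mulr_sumr -sumEFin; apply: lee_sum => n _.
  by apply: dual_step_ge => //; exact/ltW/rS.
rewrite lee_fin.
have [->|Sn0] := eqVneq S 0%R; first by rewrite mulr0 powR_ge0.
have Sp : (0 < S)%R by rewrite lt_def Sn0.
pose f := step_sum r a N.
have fn : nonneg_nonincreasing f by exact: step_sum_nonincreasing.
have Hf : head_integral u f x = S%:E.
  rewrite /head_integral integral_step_sum//; last exact: sub_half_line_ob.
  rewrite /S -sumEFin; apply: eq_bigr => n _.
  have -> : \int[mu]_(s in `]0%R, x[) ((s < r n)%R%:R * u s)%:E = (G n)%:E.
    have := primitive_below (r n) x u; rewrite {1}/primitive => ->.
    rewrite UE /G; congr EFin; have [rx|xr] := leP (r n) x.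
      by rewrite min_l// (finite_primitive_nd um UE).
    by rewrite min_r// (finite_primitive_nd um UE)// ltW.
  rewrite -EFinM; congr EFin.
  have -> : G n = (h n * V (r n))%R by rewrite divfK// gt_eqF.
  by rewrite mulrA [(a n * h n)%R]mulrC mulr_powRB1// ltW.
have aE n : (a n `^ p = h n `^ q)%R.
  rewrite /a -powRrM; congr powR.
  have : (q + p = p * q)%R by rewrite -[RHS]mulr1 -pq; field; rewrite !gt_eqF.
  lra.
(* [M] is the ratio required by [geometric_hardy], applied with the weights [V (r n)]. *)
have Nf : weighted_norm p v f <= ((M * S) `^ p^-1)%:E.
  rewrite -poweR_EFin; apply: gt0_ler_poweR; rewrite ?invr_ge0 ?(ltW p0)//.
  - rewrite in_itv/= leey andbT; apply: nonneg_integral_ge0 => //.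
    apply: nonneg_measurableM => //; apply: nonneg_measurable_powR.
    exact: nonneg_nonincreasing_measurable.
  - by rewrite in_itv/= leey andbT lee_fin mulr_ge0// ltW.
  apply: (le_trans (step_sum_norm_le N rS a0 p0 vm)).
  under eq_bigr do rewrite VE -EFinM mulrC.
  rewrite sumEFin lee_fin /S.
  under [X in (_ <= _ * X)%R]eq_bigr do rewrite -aE mulrC.
  apply: (@geometric_hardy _ p a (fun n => V (r n))) => // [|n]; first exact: ltW.
  exact: ltW.
have := weight_sup_head_integral_le wu ww UE U0 fn (proj2 cP f fn) x0.
rewrite wE UE inve_EFin_pos// Hf -!EFinM.
move=> /le_trans /(_ (lee_wpmul2l _ Nf)); rewrite lee_fin => /(_ c0).
rewrite -EFinM lee_fin powRM ?(ltW M0)// => hS.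
(* Dividing by [S^(1/p)] leaves [S^(1/q)]; this is legitimate because the finite sum [S] is a
   positive real. *)
have Sq : (S `^ q^-1 <= c * M `^ p^-1 * U x / alpha)%R.
  have Spp : (0 < S `^ p^-1)%R by exact: powR_gt0.
  have SE : S = (S `^ q^-1 * S `^ p^-1)%R.
    by rewrite -powRD ?(lt0r_neq0 Sp) ?implybT// addrC pq powRr1.
  have Ual : (0 <= U x / alpha)%R by rewrite divr_ge0// ltW.
  rewrite -(ler_pM2r Spp) -SE; move: (ler_wpM2r Ual hS).
  have -> : (alpha / U x * S * (U x / alpha) = S)%R by field; rewrite !gt_eqF.
  by move/le_trans; apply; rewrite le_eqVlt; apply/orP; left; apply/eqP; ring.
have -> : S = ((S `^ q^-1) `^ q)%R by rewrite powR_invK ?gt_eqF.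
rewrite -powRM ?powR_ge0 ?divr_ge0 ?(ltW M0) ?(ltW Ux)//.
apply: ge0_ler_powR; rewrite ?nnegrE ?(ltW q0) ?mulr_ge0 ?divr_ge0 ?powR_ge0
  ?invr_ge0 ?(ltW M0) ?(ltW Ux) ?(ltW al0)//.
have -> : (M * M `^ p^-1 * c / alpha = M / U x * (c * M `^ p^-1 * U x / alpha))%R.
  by field; rewrite !gt_eqF.
by apply: ler_wpM2l => //; rewrite divr_ge0// ltW.
Qed.

Lemma C6_le_hardy_constant p q c : (0 < p)%R -> (0 < q)%R -> (p^-1 + q^-1 = 1)%R ->
  hardy_constants p u v w c ->
  C6 q u v w <= (2 * 2 `^ p * (2 * 2 `^ p) `^ p^-1 * c)%:E.
Proof.
move=> p0 q0 pq cP; have c0 : (0 <= c)%R by case: cP.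
set M := (2 * 2 `^ p)%R.
have M0 : (0 < M)%R by rewrite mulr_gt0// powR_gt0.
have K0 : (0 <= M * M `^ p^-1 * c)%R by rewrite !mulr_ge0 ?powR_ge0// ltW.
apply/ereal_supP => _ [x + <-]; rewrite /= in_itv/= andbT => x0.
change (weight_sup u w x * dual_integral q x `^ q^-1 <= (M * M `^ p^-1 * c)%:E).
have A0 : 0 <= weight_sup u w x by exact: (weight_sup_ge0 ww UE U0).
have [Vfin|Voo] := primitive_finite_or_infinite wv; last first.
  (* For infinite [V] the convention [1 / +oo = 0] makes the whole integrand vanish. *)
  rewrite /dual_integral integral0_eq.
    by rewrite poweR0r ?invr_eq0 ?gt_eqF// mule0 lee_fin.
  move=> t; rewrite /= in_itv/= andbT => t0.
  by rewrite Voo// poweRyr ?gt_eqF// invey !mule0.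
pose V t := fine (primitive v t).
have VE t : primitive v t = (V t)%:E.
  by rewrite fineK// ge0_fin_numE ?Vfin// primitive_ge0.
have Ux := U0 x0.
(* If [V] vanishes near the origin, the indicator of a short interval has norm 0 but a positive head
   integral, so [A = 0]. *)
have [[a [a0 Va]]|V0'] := pselect (exists a : R, (0 < a)%R /\ V a = 0%R).
  have t0 : (0 < Num.min a x)%R by rewrite lt_min a0.
  have tx : (Num.min a x <= x)%R by rewrite ge_min lexx orbT.
  have Vt : V (Num.min a x) = 0%R.
    apply/le_anti; rewrite (finite_primitive_ge0 vm VE) andbT -Va.
    by apply: (finite_primitive_nd vm VE); rewrite ge_min lexx.
  have := weight_sup_primitive_le wu ww UE U0 p0 cP x0 tx.
  rewrite !UE VE Vt poweR_EFin powR0 ?invr_eq0 ?gt_eqF// mule0 => AU.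
  suff -> : weight_sup u w x = 0 by rewrite mul0e lee_fin.
  apply/eqP; rewrite eq_le A0 andbT leNgt; apply/negP => Apos.
  move: AU; rewrite leNgt inve_EFin_pos// !mule_gt0// lte_fin ?invr_gt0//.
  exact: U0.
have V0 t : (0 < t)%R -> (0 < V t)%R.
  move=> t0; rewrite lt_neqAle (finite_primitive_ge0 vm VE) andbT eq_sym.
  by apply/eqP => Vt; apply: V0'; exists t.
have Afin : weight_sup u w x <= (c * V x `^ p^-1)%:E.
  have := weight_sup_primitive_le wu ww UE U0 p0 cP x0 (lexx x).
  by rewrite UE inve_EFin_pos// -muleA -EFinM mulVf ?gt_eqF// mule1 VE.
have [alpha al0 wE] : exists2 alpha, (0 <= alpha)%R & weight_sup u w x = alpha%:E.
  by case: (weight_sup u w x) A0 Afin => [alpha|//|//] h _; exists alpha.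
rewrite wE; have [->|aln0] := eqVneq alpha 0%R; first by rewrite mul0e lee_fin.
have alpos : (0 < alpha)%R by rewrite lt_def aln0.
have dm := nonneg_measurable_dual_density um vm UE VE q x0.
have M1 : (1 < M)%R.
  have := @ler_powR R 2 (ler1n _ 2) _ _ (ltW p0); rewrite powRr0 /M => h.
  by move: h; set y := (_ `^ _)%R; lra.
(* The ladder bound is independent of [a] and [b], so exhausting the half-line from both ends
   preserves it. *)
have JK : dual_integral q x <= ((M * M `^ p^-1 * c / alpha) `^ q)%:E.
  rewrite (dual_integralE VE)//.
  apply: nonneg_integral_exhaust_right => // b b0.
  apply: nonneg_integral_exhaust_left => // a a0 ab.
  have [r [rb Vr r0 rS rlim]] := geometric_levels vm VE M1 (V0 b b0).
  have [n rn] := rlim a (V0 a a0).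
  have rV k : (V (r k) = M * V (r k.+1))%R.
    by rewrite !Vr exprS; field; rewrite expf_neq0 ?gt_eqF.
  apply: le_trans (dual_ladder_le n VE V0 p0 q0 pq cP x0 alpos wE rV r0 rS rb).
  apply: nonneg_integral_sub => //; last exact: sub_half_line_cb.
  by move=> s/=; rewrite !in_itv/= => /andP[as_ ->]; rewrite (le_trans (ltW rn)).
apply: (@le_trans _ _ (alpha%:E * (((M * M `^ p^-1 * c / alpha) `^ q)%:E `^ q^-1))).
  apply: lee_wpmul2l; first by rewrite lee_fin.
  apply: gt0_ler_poweR; rewrite ?invr_ge0 ?(ltW q0)//.
    by rewrite in_itv/= leey andbT dual_integral_ge0.
  by rewrite in_itv/= leey andbT lee_fin powR_ge0.
rewrite poweR_EFin -powRrM mulfV ?gt_eqF// powRr1 ?divr_ge0// -EFinM.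
by rewrite mulrC divfK.
Qed.

End dual_constant.

(** * Finiteness of [U] and assembly of the two equivalences *)

Lemma admissible_finite (R : realType) (u : R -> R) : weight u ->
  admissible (primitive u) -> exists U : R -> R, forall t, primitive u t = (U t)%:E.
Proof.
move=> wu [_ inc _ _]; exists (fun t => fine (primitive u t)) => t.
have um := weight_nonneg_measurable wu.
rewrite fineK// ge0_fin_numE ?primitive_ge0//.
have [t0|t0] := leP 0%R t; last by rewrite primitive_le0 ?ltry// ltW.
(* Strict monotonicity puts [U t] strictly below [U (t + 1)], hence below [+oo]. *)
by apply: lt_le_trans (inc t (t + 1)%R t0 _) (leey _); rewrite ltrDl.
Qed.

Theorem theorem5p4 (R : realType) (p : R) (p_gt0 : (0 < p)%R) :
  exists2 lam : R, (0 < lam)%R &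
  forall u v w : R -> R,
    weight u -> weight v -> weight w ->
    primitive v t @[t --> +oo%R] --> +oo ->
    (forall t : R, (0 < t)%R -> 0 < primitive u t) ->
    admissible (primitive u) ->
    nondegenerate_wrt (primitive u) (fundamental (primitive u) w) ->
    ((p <= 1)%R ->
       ((exists c : R, hardy_constants p u v w c) <-> C5 p u v w < +oo) /\
       approx_with lam (best_const p u v w) (C5 p u v w)) /\
    ((1 < p)%R -> forall p' : R, (p^-1 + p'^-1 = 1)%R ->
       ((exists c : R, hardy_constants p u v w c) <-> C6 p' u v w < +oo) /\
       approx_with lam (best_const p u v w) (C6 p' u v w)).
Proof.
set F := (4 `^ p^-1 : R)%R.
set K := (2 * 2 `^ p * (2 * 2 `^ p) `^ p^-1 : R)%R.
have F0 : (0 <= F)%R by exact: powR_ge0.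
have K0 : (0 <= K)%R by rewrite !mulr_ge0 ?powR_ge0.
(* One constant serves all four estimates: [12 * F] dominates the sufficiency factors [3 * (2 * F)]
   and [3 * (4 * F)], [K] is the necessity factor for [C6], and 1 the one for [C5]. *)
have lam0 : (0 < 12 * F + K + 1)%R by lra.
exists (12 * F + K + 1)%R => // u v w wu wv ww vlim u_gt0 uadm _.
have [U UE] := admissible_finite wu uadm.
have U0 (t : R) : (0 < t)%R -> (0 < U t)%R by move=> /u_gt0; rewrite UE lte_fin.
split => [p1|p1 q pq].
- apply: best_const_approx => //; first exact: (C5_ge0 v wu ww UE U0).
    move=> c cP; apply: le_trans (C5_le_hardy_constant wu wv ww UE U0 p_gt0 cP) _.
    by rewrite lee_fin ler_peMl; [|case: cP|lra].
  move=> c c0 Cc; apply: hardy_constants_le (hardy_constants_of_C5 wu wv ww UE U0 p_gt0 p1 c0 Cc).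
  by apply: ler_wpM2r; [exact: ltW|rewrite -/F; lra].
- have q0 : (0 < q)%R.
    have : (p^-1 < 1)%R by rewrite invf_lt1.
    by rewrite -invr_gt0; lra.
  apply: best_const_approx => //; first exact: (C6_ge0 v ww UE U0).
    move=> c cP; apply: le_trans (C6_le_hardy_constant wu wv ww UE U0 p_gt0 q0 pq cP) _.
    by rewrite lee_fin -/K; apply: ler_wpM2r; [case: cP|lra].
  move=> c c0 Cc.
  apply: hardy_constants_le (hardy_constants_of_C6 wu wv ww UE U0 p1 pq c0 vlim Cc).
  by apply: ler_wpM2r; [exact: ltW|rewrite -/F; lra].
Qed.
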